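(* Let $f=(f(m,k))\in\prod_{HSG}\mathbb{Z}$. If $\sup_{m,k}|f(m,k)|<\infty$, then $ST(f)$ is summable for any $p>\log 3/\log 2$.
   Context: Gasket. Let $\Delta_{0,1}$ be (the boundary curve of) an equilateral triangle in the plane of circumference $2\pi$ with one vertex pointing upwards. The Sierpinski gasket $SG$ is the intersection of the decreasing sequence of compact sets that starts with the solid triangle bounded by $\Delta_{0,1}$ and where at each step, from every remaining solid triangle, the open upside-down middle triangle (with vertices the edge midpoints) is removed. For $m\ge 1$, $\nabla_{m,k}$ $(1\le k\le 3^{m-1})$ are the boundary curves, of circumference $2\pi/2^m$, of the upside-down triangles removed at step $m$. Put $HSG=\{(m,k): m\in\mathbb{N},\ 1\le k\le 3^{m-1}\}$. Modules. For a triangle $T\subset SG$ of circumference $2\pi r$, let $\rho:[-\pi r,\pi r]\to T$ be its closed counterclockwise arc-length parametrization. $UFM(T)$ is the unbounded Fredholm module over $C(SG)$ with Hilbert space $H=L^2([-\pi r,\pi r],\tfrac{dx}{2\pi r})$, representation $\pi(a)\xi(x)=a(\rho(x))\xi(x)$, and Dirac operator $D$ the selfadjoint operator with $D e^{ilx/r}=\tfrac{1}{r}(l+\tfrac12)e^{ilx/r}$, $l\in\mathbb{Z}$ (i.e. $\tfrac1i\tfrac{d}{dx}+\tfrac1{2r}$ with periodic boundary conditions). $\overline{UFM(T)}$ is the same with the orientation of the parametrization reversed. Direct sums. $ZGT:=\overline{UFM(\Delta_{0,1})}\oplus\bigoplus_{m=1}^\infty\bigoplus_{k=1}^{3^{m-1}}UFM(\nabla_{m,k})$.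 For $f\in\prod_{HSG}\mathbb{Z}$, $UFM(f)$ is the direct sum over all $(m,k)\in HSG$ with $f(m,k)\ne0$ of $f(m,k)$ copies of $UFM(\nabla_{m,k})$ if $f(m,k)>0$, and of $-f(m,k)$ copies of $\overline{UFM(\nabla_{m,k})}$ if $f(m,k)<0$. $ST(f):=ZGT\oplus UFM(f)$. With $D_f$ the Dirac operator of $ST(f)$, $ST(f)$ is summable for $p$ if $\mathrm{Tr}((I+D_f^2)^{-p/2})<\infty$. *)

(* Defs.v *)
From HB Require Import structures.
From mathcomp Require Import all_boot all_order all_algebra.
From mathcomp Require Import sesquilinear ring_quotient generic_quotient.
From mathcomp Require Import all_classical all_reals all_analysis measurable_realfun.
From mathcomp Require Import complex.
From mathcomp Require Import ring lra.

Set Implicit Arguments.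
Unset Strict Implicit.
Unset Printing Implicit Defensive.

Import Order.TTheory GRing.Theory Num.Theory.
Import numFieldNormedType.Exports.

Local Open Scope classical_set_scope.
Local Open Scope complex_scope.
Local Open Scope ring_scope.

Local Notation cRe := (@complex.Re _).
Local Notation cIm := (@complex.Im _).

(* Inner products are linear in the first argument. Completeness is not a field:
   the Hilbert spaces used below, L2 of a measure and l2-direct sums of such
   spaces, are complete. *)
Record prehilbert (R : realType) := PreHilbert {
  ph_sort :> lmodType R[i];
  ph_dot : {dot ph_sort for Num.conj} }.

Notation "''<' u , v >" := (ph_dot _ u v)
  (at level 0, u, v at level 50, format "''<' u ,  v >") : ring_scope.

Section PreHilbertTheory.
Variables (R : realType) (H : prehilbert R).
Implicit Types u v : H.

Definition normsq u : R := cRe '<u, u>.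

Lemma conj_complexE (z : R[i]) : z^* = (cRe z) -i* (cIm z).
Proof. by case: z. Qed.

Lemma dotC u v : '<u, v> = '<v, u>^*.
Proof. by rewrite hermC expr0 mul1r. Qed.

Lemma dotDl u v w : '<u + v, w> = '<u, w> + '<v, w>.
Proof. by rewrite linearDl. Qed.
Lemma dotDr u v w : '<w, u + v> = '<w, u> + '<w, v>.
Proof. by rewrite linearDr. Qed.
Lemma dotZl a u v : '<a *: u, v> = a * '<u, v>.
Proof. by rewrite linearZl_LR. Qed.
Lemma dotZr a u v : '<u, a *: v> = a^* * '<u, v>.
Proof. by rewrite linearZr_LR. Qed.


Lemma dotE u : '<u, u> = (normsq u)%:C.
Proof.
have := dotC u u; rewrite conj_complexE /normsq.
by case: '<u, u> => a b /= [] /eqP; rewrite -subr_eq0 opprK -mulr2n mulrn_eq0 => /eqP ->.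
Qed.

Lemma normsq_eq0 u : normsq u = 0 -> u = 0.
Proof.
move=> u0; apply/eqP/negPn/negP; rewrite -(dnorm_gt0 (ph_dot H)).
by rewrite dotE u0 ltxx.
Qed.

Lemma normsq0 : normsq (0 : H) = 0.
Proof. by rewrite /normsq linear0l. Qed.

Lemma normsq_ge0 u : 0 <= normsq u.
Proof.
by rewrite -ler0c -dotE dnorm_ge0.
Qed.

Lemma normsqD u v : normsq (u + v) = normsq u + normsq v + (cRe '<u, v>) *+ 2.
Proof.
rewrite /normsq dotDl !dotDr (dotC v u) conj_complexE !raddfD /=.
by rewrite mulr2n; ring.
Qed.

Lemma normsqZ a u : normsq (a *: u) = (cRe a ^+ 2 + cIm a ^+ 2) * normsq u.
Proof.
rewrite /normsq dotZl dotZr dotE conj_complexE.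
by case: a => a b /=; ring.
Qed.

Lemma normsqN u : normsq (- u) = normsq u.
Proof. by rewrite -scaleN1r normsqZ /= oppr0 sqrrN expr0n /= addr0 expr1n mul1r. Qed.

Lemma Re_dot_le u v : `|cRe '<u, v>| <= normsq u + normsq v.
Proof.
have := normsq_ge0 (u + v); have := normsq_ge0 (u - v).
rewrite !normsqD normsqN.
have -> : '<u, - v> = - '<u, v> by rewrite -scaleN1r dotZr rmorphN rmorph1 mulN1r.
have := normsq_ge0 u; have := normsq_ge0 v.
rewrite raddfN /= !mulr2n ler_norml => *; apply/andP; split; lra.
Qed.

Lemma Im_dot_le u v : `|cIm '<u, v>| <= normsq u + normsq v.
Proof.
have := Re_dot_le ('i *: u) v.
rewrite normsqZ dotZl mulrC ReiNIm normrN /= expr0n expr1n add0r mul1r.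
exact.
Qed.

Lemma normsqD_le u v : normsq (u + v) <= (normsq u + normsq v) *+ 2.
Proof.
have := normsq_ge0 (u - v); rewrite !normsqD normsqN.
have -> : '<u, - v> = - '<u, v> by rewrite -scaleN1r dotZr rmorphN rmorph1 mulN1r.
by rewrite raddfN /= !mulr2n => *; lra.
Qed.

End PreHilbertTheory.

Section UnorderedSum.
Variables (R : realType) (I : choiceType).
Implicit Types (u v w p q : I -> R) (z : I -> R[i]).

Definition abs_summable u := (\esum_(i in [set: I]) `|u i|%:E < +oo)%E.

(* The sum of an absolutely summable family, in no particular order. *)
Definition rsum u : R :=
  fine (\esum_(i in [set: I]) (Num.max (u i) 0)%:E) -
  fine (\esum_(i in [set: I]) (Num.max (- u i) 0)%:E).

Definition csum z : R[i] := rsum (cRe \o z) +i* rsum (cIm \o z).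

Lemma esum_fin p : (forall i, 0 <= p i) -> abs_summable p ->
  (\esum_(i in [set: I]) (p i)%:E = (fine (\esum_(i in [set: I]) (p i)%:E))%:E)%E.
Proof.
move=> p0 sp; rewrite fineK// ge0_fin_numE ?esum_ge0//; last first.
  by move=> i _; rewrite lee_fin.
by move: sp; rewrite /abs_summable; under eq_esum do rewrite ger0_norm//.
Qed.

Lemma abs_summable_le u v : (forall i, `|u i| <= `|v i|) ->
  abs_summable v -> abs_summable u.
Proof. by move=> uv; apply: le_lt_trans; apply: le_esum => i _; rewrite lee_fin. Qed.

Lemma abs_summableD u v : abs_summable u -> abs_summable v ->
  abs_summable (fun i => u i + v i).
Proof.
move=> su sv; apply: (@le_lt_trans _ _ (\esum_(i in [set: I]) (`|u i|%:E + `|v i|%:E)%E)).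
  by apply: le_esum => i _; rewrite -EFinD lee_fin ler_normD.
by rewrite esumD ?lte_add_pinfty// => i _; rewrite lee_fin.
Qed.

Lemma esumZ_le (c : R) p : 0 <= c -> (forall i, 0 <= p i) ->
  (\esum_(i in [set: I]) (c * p i)%:E <= c%:E * \esum_(i in [set: I]) (p i)%:E)%E.
Proof.
move=> c0 p0; apply: ge_ereal_sup => _ [A [finA _] <-].
under eq_fsbigr do rewrite EFinM.
rewrite -ge0_mule_fsumr; last by move=> i; rewrite lee_fin.
apply: lee_wpmul2l; first by rewrite lee_fin.
by apply: ereal_sup_ubound; exists A.
Qed.

Lemma abs_summableZ c u : abs_summable u -> abs_summable (fun i => c * u i).
Proof.
move=> su; rewrite /abs_summable; under eq_esum do rewrite normrM.
apply: le_lt_trans (esumZ_le _ _) _ => //.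
by rewrite lte_mul_pinfty// lee_fin.
Qed.

Lemma rsum_pn p q : (forall i, 0 <= p i) -> (forall i, 0 <= q i) ->
  abs_summable p -> abs_summable q ->
  rsum (fun i => p i - q i) = fine (\esum_(i in [set: I]) (p i)%:E) -
                              fine (\esum_(i in [set: I]) (q i)%:E).
Proof.
move=> p0 q0 sp sq; rewrite /rsum.
have s1 : abs_summable (fun i => Num.max (p i - q i) 0).
  apply: abs_summable_le sp => i; have := p0 i; have := q0 i.
  by case: (leP (p i - q i) 0) => *; rewrite !ger0_norm//; lra.
have s2 : abs_summable (fun i => Num.max (- (p i - q i)) 0).
  apply: abs_summable_le sq => i; have := p0 i; have := q0 i.
  by case: (leP (- (p i - q i)) 0) => *; rewrite !ger0_norm//; lra.
have m1 i : 0 <= Num.max (p i - q i) 0 by rewrite le_max lexx orbT.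
have m2 i : 0 <= Num.max (- (p i - q i)) 0 by rewrite le_max lexx orbT.
have : (\esum_(i in [set: I]) ((Num.max (p i - q i) 0)%:E + (q i)%:E) =
        \esum_(i in [set: I]) ((Num.max (- (p i - q i)) 0)%:E + (p i)%:E))%E.
  apply: eq_esum => i _; rewrite -!EFinD; congr EFin.
  by case: (leP (p i - q i) 0); case: (leP (- (p i - q i)) 0) => *; lra.
rewrite !esumD//; try by move=> i _; rewrite lee_fin.
rewrite (esum_fin m1)// (esum_fin m2)// (esum_fin p0)// (esum_fin q0)//.
by rewrite -!EFinD => -[] /=; lra.
Qed.

Lemma rsumD u v : abs_summable u -> abs_summable v ->
  rsum (fun i => u i + v i) = rsum u + rsum v.
Proof.
have s1 w : abs_summable w -> abs_summable (fun i => Num.max (w i) 0).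
  apply: abs_summable_le => i.
  by case: (leP (w i) 0) => *; rewrite ?normr0.
have s2 w : abs_summable w -> abs_summable (fun i => Num.max (- w i) 0).
  apply: abs_summable_le => i.
  by case: (leP (- w i) 0) => *; rewrite ?normr0 ?normrN.
have m1 w i : 0 <= Num.max (w i) 0 :> R by rewrite le_max lexx orbT.
move=> su sv.
rewrite (_ : (fun i => _) = (fun i => (Num.max (u i) 0 + Num.max (v i) 0) -
                     (Num.max (- u i) 0 + Num.max (- v i) 0))); last first.
  apply/funext => i.
  by case: (leP (u i) 0); case: (leP (v i) 0); case: (leP (- u i) 0);
     case: (leP (- v i) 0) => *; lra.
rewrite rsum_pn; last 4 first.
- by move=> i; rewrite addr_ge0.
- by move=> i; rewrite addr_ge0// (m1 (fun i => - _ i)).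
- by apply: abs_summableD; exact: s1.
- by apply: abs_summableD; exact: s2.
under eq_esum do rewrite EFinD; under [in X in _ - X]eq_esum do rewrite EFinD.
rewrite !esumD; try by move=> i _; rewrite lee_fin// ?(m1 (fun i => - _ i)).
rewrite !fineD /rsum; first by lra.
all: rewrite esum_fin//; try by (exact: s1 || exact: s2).
all: by move=> i; rewrite (m1 (fun i => - _ i)).
Qed.

Lemma rsumN u : rsum (fun i => - u i) = - rsum u.
Proof. by rewrite /rsum opprB; under [in X in _ - X]eq_esum do rewrite opprK. Qed.

Lemma rsumZ_ge0 c u : 0 <= c -> abs_summable u -> rsum (fun i => c * u i) = c * rsum u.
Proof.
have m1 w i : 0 <= Num.max (w i) 0 :> R by rewrite le_max lexx orbT.
have s1 w : abs_summable w -> abs_summable (fun i => Num.max (w i) 0).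
  apply: abs_summable_le => i.
  by case: (leP (w i) 0) => *; rewrite ?normr0.
rewrite le_eqVlt => /predU1P[<- _|c0 su].
  rewrite mul0r /rsum.
  rewrite !esum1 ?subr0//= => i _; by rewrite mul0r ?oppr0 maxxx.
have H w : abs_summable w -> (\esum_(i in [set: I]) (Num.max (c * w i) 0)%:E =
  c%:E * \esum_(i in [set: I]) (Num.max (w i) 0)%:E)%E.
  move=> sw; apply/le_anti/andP; split.
    rewrite (_ : (fun i => _) = (fun i => (c * Num.max (w i) 0)%:E)).
      by apply: esumZ_le => //; exact: ltW.
    by apply/funext => i; rewrite maxr_pMr ?mulr0// ltW.
  have := @esumZ_le c^-1 (fun i => Num.max (c * w i) 0).
  rewrite invr_ge0 ltW// => /(_ erefl (m1 _)).
  rewrite (_ : (fun i => _) = (fun i => (Num.max (w i) 0)%:E)); last first.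
    apply/funext => i; rewrite maxr_pMr ?mulr0 ?invr_ge0 ?ltW// mulKf//.
    by rewrite gt_eqF.
  move=> h; have := lee_wpmul2l _ h => /(_ c%:E).
  by rewrite lee_fin ltW// muleA -EFinM divff ?gt_eqF// mul1e => /(_ erefl).
rewrite /rsum H//; under [in X in _ - X]eq_esum do rewrite -mulrN.
rewrite (H (fun i => - u i)); last first.
  by apply: abs_summable_le su => i; rewrite normrN.
rewrite !fineM//; first by rewrite mulrBr.
all: rewrite esum_fin//; try by exact: s1.
  exact: (m1 (fun i => - u i)).
by apply: (s1 (fun i => - u i)); apply: abs_summable_le su => i; rewrite normrN.
Qed.

Lemma rsumZ c u : abs_summable u -> rsum (fun i => c * u i) = c * rsum u.
Proof.
move=> su; have [|c0] := leP 0 c; first by move=> ?; exact: rsumZ_ge0.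
have -> : (fun i => c * u i) = (fun i => - (- c * u i)).
  by apply/funext => i; rewrite mulNr opprK.
by rewrite rsumN rsumZ_ge0 ?mulNr ?opprK// oppr_ge0 ltW.
Qed.

Definition cabs_summable z := abs_summable (cRe \o z) /\ abs_summable (cIm \o z).

Lemma csumD z (w : I -> R[i]) : cabs_summable z -> cabs_summable w ->
  csum (fun i => z i + w i) = csum z + csum w.
Proof.
move=> [z1 z2] [w1 w2]; rewrite /csum.
have -> : cRe \o (fun i => z i + w i) = (fun i => (cRe \o z) i + (cRe \o w) i).
  by apply/funext => i; rewrite /= raddfD.
have -> : cIm \o (fun i => z i + w i) = (fun i => (cIm \o z) i + (cIm \o w) i).
  by apply/funext => i; rewrite /= raddfD.
by rewrite !rsumD.
Qed.

Lemma csumZ (a : R[i]) z : cabs_summable z -> csum (fun i => a * z i) = a * csum z.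
Proof.
move=> [z1 z2]; rewrite /csum.
have -> : cRe \o (fun i => a * z i) =
    (fun i => cRe a * (cRe \o z) i + (- cIm a) * (cIm \o z) i).
  by apply/funext => i; rewrite /=; case: a (z i) => ? ? [? ?] /=; rewrite mulNr.
have -> : cIm \o (fun i => a * z i) =
    (fun i => cRe a * (cIm \o z) i + cIm a * (cRe \o z) i).
  by apply/funext => i; rewrite /=; case: a (z i) => ? ? [? ?] /=.
rewrite !rsumD ?rsumZ//; try exact: abs_summableZ.
case: a => a b /=; apply/eqP; rewrite eq_complex /=; apply/andP; split; apply/eqP. all: ring.
Qed.

Lemma csum_conj z : csum (fun i => (z i)^*) = (csum z)^*.
Proof.
rewrite conj_complexE /csum /= -rsumN; congr (rsum _ +i* rsum _).
  by apply/funext => i; rewrite /= conj_complexE.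
by apply/funext => i; rewrite /= conj_complexE.
Qed.

End UnorderedSum.

Section DirectSum.
Variables (R : realType) (I : choiceType) (H : I -> prehilbert R).

Record dsum_sort : Type := DSum {
  fam :> forall i, H i;
  fam_sq : (\esum_(i in [set: I]) (normsq (fam i))%:E < +oo)%E }.

HB.instance Definition _ := gen_eqMixin dsum_sort.
HB.instance Definition _ := gen_choiceMixin dsum_sort.

Implicit Types x y z : dsum_sort.

Lemma fam_inj x y : (forall i, x i = y i) -> x = y.
Proof.
case: x y => [x hx] [y hy] /= xy.
have {}xy : x = y by exact: functional_extensionality_dep.
by subst y; congr DSum; exact: Prop_irrelevance.
Qed.

Lemma dsum_abs_normsq x : abs_summable (fun i => normsq (x i)).
Proof.
by rewrite /abs_summable; under eq_esum do rewrite ger0_norm ?normsq_ge0//; exact: fam_sq.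
Qed.

Lemma dsum_sq_subproof (x : forall i, H i) (u : I -> R) :
  abs_summable u -> (forall i, normsq (x i) <= u i) ->
  (\esum_(i in [set: I]) (normsq (x i))%:E < +oo)%E.
Proof.
move=> su xu; apply: le_lt_trans su; apply: le_esum => i _.
by rewrite lee_fin (le_trans (xu i))// ler_norm.
Qed.

Fact dsum_zero_sq : (\esum_(i in [set: I]) (normsq (0 : H i))%:E < +oo)%E.
Proof. by rewrite esum1// => i _; rewrite normsq0. Qed.

Fact dsum_opp_sq x : (\esum_(i in [set: I]) (normsq (- x i))%:E < +oo)%E.
Proof. by under eq_esum do rewrite normsqN; exact: fam_sq. Qed.

Fact dsum_add_sq x y : (\esum_(i in [set: I]) (normsq (x i + y i))%:E < +oo)%E.
Proof.
apply: (@dsum_sq_subproof _ (fun i => 2 * (normsq (x i) + normsq (y i)))).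
  by apply/abs_summableZ/abs_summableD; exact: dsum_abs_normsq.
by move=> i; rewrite mulr_natl normsqD_le.
Qed.

Fact dsum_scale_sq a x : (\esum_(i in [set: I]) (normsq (a *: x i))%:E < +oo)%E.
Proof.
apply: (@dsum_sq_subproof _ (fun i => (cRe a ^+ 2 + cIm a ^+ 2) * normsq (x i))).
  by apply/abs_summableZ; exact: dsum_abs_normsq.
by move=> i; rewrite normsqZ.
Qed.

Definition dsum_zero := DSum dsum_zero_sq.
Definition dsum_opp x := DSum (dsum_opp_sq x).
Definition dsum_add x y := DSum (dsum_add_sq x y).
Definition dsum_scale a x := DSum (dsum_scale_sq a x).

Fact dsum_addA : associative dsum_add.
Proof. by move=> x y z; apply: fam_inj => i /=; rewrite addrA. Qed.
Fact dsum_addC : commutative dsum_add.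
Proof. by move=> x y; apply: fam_inj => i /=; rewrite addrC. Qed.
Fact dsum_add0 : left_id dsum_zero dsum_add.
Proof. by move=> x; apply: fam_inj => i /=; rewrite add0r. Qed.
Fact dsum_addN : left_inverse dsum_zero dsum_opp dsum_add.
Proof. by move=> x; apply: fam_inj => i /=; rewrite addNr. Qed.

HB.instance Definition _ :=
  GRing.isZmodule.Build dsum_sort dsum_addA dsum_addC dsum_add0 dsum_addN.

Fact dsum_scaleA a b x : dsum_scale a (dsum_scale b x) = dsum_scale (a * b) x.
Proof. by apply: fam_inj => i /=; rewrite scalerA. Qed.
Fact dsum_scale1 : left_id 1 dsum_scale.
Proof. by move=> x; apply: fam_inj => i /=; rewrite scale1r. Qed.
Fact dsum_scaleDr : right_distributive dsum_scale +%R.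
Proof. by move=> a x y; apply: fam_inj => i /=; rewrite scalerDr. Qed.
Fact dsum_scaleDl x : {morph dsum_scale^~ x : a b / a + b}.
Proof. by move=> a b; apply: fam_inj => i /=; rewrite scalerDl. Qed.

HB.instance Definition _ := GRing.Zmodule_isLmodule.Build R[i] dsum_sort
  dsum_scaleA dsum_scale1 dsum_scaleDr dsum_scaleDl.

Definition dsum_dot x y : R[i] := csum (fun i => '<x i, y i>).

Lemma dsum_cabs x y : cabs_summable (fun i => '<x i, y i>).
Proof.
have s : abs_summable (fun i => normsq (x i) + normsq (y i)).
  by apply: abs_summableD; exact: dsum_abs_normsq.
split; apply: abs_summable_le s => i; rewrite [leRHS]ger0_norm ?addr_ge0 ?normsq_ge0//.
  exact: Re_dot_le.
exact: Im_dot_le.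
Qed.

Fact dsum_dot_herm x y : dsum_dot x y = (-1) ^+ false * (dsum_dot y x)^*.
Proof.
rewrite expr0 mul1r -csum_conj; congr csum; apply/funext => i.
exact: dotC.
Qed.

Fact dsum_dot_linl y : GRing.linear_for *%R (dsum_dot^~ y).
Proof.
move=> a u v; rewrite /dsum_dot -csumZ; last exact: dsum_cabs.
rewrite -csumD; last 2 first.
- have := dsum_cabs (a *: u) y; congr cabs_summable.
  by apply/funext => i; rewrite dotZl.
- exact: dsum_cabs.
by congr csum; apply/funext => i; rewrite dotDl dotZl.
Qed.

Fact dsum_dot_bilin :
  bilinear_for *%R ((Num.conj : R[i] -> R[i]) \; *%R) dsum_dot.
Proof.
split=> [|u a v w]; first exact: dsum_dot_linl.
have hC x y : dsum_dot x y = (dsum_dot y x)^* by rewrite dsum_dot_herm mul1r.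
by rewrite hC dsum_dot_linl rmorphD rmorphM /= -!hC.
Qed.

Fact dsum_dot_gt0 x : x != 0 -> 0 < dsum_dot x x.
Proof.
move=> x0.
have -> : dsum_dot x x = (fine (\esum_(i in [set: I]) (normsq (x i))%:E))%:C.
  rewrite /dsum_dot /csum /rsum; apply/eqP; rewrite eq_complex /=.
  rewrite [X in fine X - _](_ : _ = \esum_(i in [set: I]) (normsq (x i))%:E); last first.
    by apply: eq_esum => i _; rewrite max_l// normsq_ge0.
  rewrite (@esum1 _ _ _ (fun i => (Num.max (- cRe '<x i, x i>) 0)%:E)); last first.
    by move=> i _; rewrite max_r// oppr_le0 normsq_ge0.
  rewrite !(@esum1 _ _ _ (fun i => (Num.max _ 0)%:E)); last 2 first.
  - by move=> i _; rewrite dotE /= oppr0 maxxx.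
  - by move=> i _; rewrite dotE /= maxxx.
  by rewrite !subr0 !eqxx.
rewrite ltcR lt_neqAle fine_ge0 ?esum_ge0// ?andbT; last first.
  by move=> i _; rewrite lee_fin normsq_ge0.
apply: contra x0 => /eqP x0; apply/eqP/fam_inj => i.
apply: normsq_eq0; apply/le_anti; rewrite normsq_ge0 andbT.
have -> : 0 = fine (\esum_(i in [set: I]) (normsq (x i))%:E) by [].
rewrite -lee_fin -esum_fin; last 2 first.
- by move=> j; exact: normsq_ge0.
- exact: dsum_abs_normsq.
apply: esum_ge; exists [set i]; first by split => //; exact: finite_set1.
by rewrite fsbig_set1.
Qed.

HB.instance Definition _ := bilinear_isBilinear.Build R[i] dsum_sort dsum_sort R[i]
  *%R (Num.conj \; *%R) dsum_dot dsum_dot_bilin.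
HB.instance Definition _ := isHermitianSesquilinear.Build R[i] dsum_sort
  false Num.conj dsum_dot dsum_dot_herm.
HB.instance Definition _ := isDotProduct.Build R[i] dsum_sort dsum_dot dsum_dot_gt0.

Definition dsum : prehilbert R := @PreHilbert R dsum_sort dsum_dot.

End DirectSum.

Section L2.
Context d (T : measurableType d) (R : realType).
Variable mu : {measure set T -> \bar R}.
Implicit Types f g : T -> R[i].

Definition L2_pred : {pred T -> R[i]} :=
  [pred f : T -> R[i] | (cRe \o f \in Lfun mu 2%:E) && (cIm \o f \in Lfun mu 2%:E)].

Fact Lfun2_lin (a b : R) (u v : T -> R) : u \in Lfun mu 2%:E -> v \in Lfun mu 2%:E ->
  (fun t => a * u t + b * v t) \in Lfun mu 2%:E.
Proof.
have [L0 LD] := Lfun_submod_closed mu (lee1n 2).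
move=> Lu Lv; have Lbv : (b *: v : T -> R) \in Lfun mu 2%:E.
  by have := LD b v 0 Lv L0; rewrite addr0.
exact: (LD a u _ Lu Lbv).
Qed.

Fact L2_submod_closed : submod_closed L2_pred.
Proof.
have [L0 _] := Lfun_submod_closed mu (lee1n 2).
split=> [|a f g /andP[f1 f2] /andP[g1 g2]]; first by rewrite inE; apply/andP; split.
rewrite inE; apply/andP; split.
  rewrite (_ : _ \o _ = fun t =>
    1 * (cRe a * cRe (f t) + - cIm a * cIm (f t)) + 1 * cRe (g t)).
    exact: Lfun2_lin (Lfun2_lin _ _ f1 f2) g1.
  apply/funext => t /=; rewrite !mul1r raddfD /= mulNr -[(a *: f) t]/(a * f t).
  by case: a (f t) => ? ? [? ?].
rewrite (_ : _ \o _ = fun t =>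
  1 * (cRe a * cIm (f t) + cIm a * cRe (f t)) + 1 * cIm (g t)).
  exact: Lfun2_lin (Lfun2_lin _ _ f2 f1) g2.
apply/funext => t /=; rewrite !mul1r raddfD /= -[(a *: f) t]/(a * f t).
by case: a (f t) => ? ? [? ?].
Qed.

HB.instance Definition _ := GRing.isSubmodClosed.Build R[i] (T -> R[i]) L2_pred
  L2_submod_closed.

Record L2fun : Type := L2Fun { L2_fun :> T -> R[i]; L2_funP : L2_fun \in L2_pred }.

HB.instance Definition _ := [isSub for L2_fun].
HB.instance Definition _ := [Choice of L2fun by <:].
HB.instance Definition _ := [SubChoice_isSubLmodule of L2fun by <:].

Definition null_pred : {pred L2fun} := [pred u : L2fun | `[< {ae mu, forall t, u t = 0} >]].

Fact null_zmod_closed : zmod_closed null_pred.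
Proof.
split=> [|u v /asboolP u0 /asboolP v0]; apply/asboolP; first exact: aeW.
apply: filterS2 u0 v0 => t ut vt.
by rewrite -[(u - v) t]/(u t - v t) ut vt subr0.
Qed.

HB.instance Definition _ := GRing.isZmodClosed.Build L2fun null_pred null_zmod_closed.

Definition L2_sort : Type := Quotient.quot null_pred.
HB.instance Definition _ := GRing.Zmodule.on L2_sort.
Definition L2_class (u : L2fun) : L2_sort := \pi_(Quotient.quot null_pred)%qT u.
Definition L2_repr (x : L2_sort) : L2fun := repr (x : Quotient.quot null_pred).

Implicit Types u v w : L2fun.

Lemma L2funDE u v t : (u + v) t = u t + v t. Proof. by []. Qed.
Lemma L2funBE u v t : (u - v) t = u t - v t. Proof. by []. Qed.
Lemma L2funZE a u t : (a *: u) t = a * u t. Proof. by []. Qed.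

Lemma L2_classP u v : L2_class u = L2_class v <-> {ae mu, forall t, u t = v t}.
Proof.
have E : (L2_class u == L2_class v) = (u - v \in null_pred).
  by rewrite Quotient.idealrBE.
split=> [/eqP|uv]; last apply/eqP; rewrite E.
  move=> /asboolP; apply: filterS => t.
  by rewrite L2funBE => /eqP; rewrite subr_eq0 => /eqP.
by apply/asboolP; apply: filterS uv => t uvt; rewrite L2funBE uvt subrr.
Qed.

Lemma L2_reprK (x : L2_sort) : L2_class (L2_repr x) = x.
Proof. exact: reprK. Qed.

Lemma L2_classK u : {ae mu, forall t, L2_repr (L2_class u) t = u t}.
Proof. by apply/L2_classP; rewrite L2_reprK. Qed.

Lemma L2_classD u v : L2_class (u + v) = L2_class u + L2_class v.
Proof. by rewrite /L2_class !piE. Qed.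

Lemma L2_class0 : L2_class 0 = 0.
Proof. by rewrite /L2_class !piE. Qed.

Definition L2_scale (a : R[i]) (x : L2_sort) : L2_sort := L2_class (a *: L2_repr x).

Lemma L2_classZ a u : L2_scale a (L2_class u) = L2_class (a *: u).
Proof.
apply/L2_classP; apply: filterS (L2_classK u) => t ut.
by rewrite !L2funZE ut.
Qed.

Fact L2_scaleA a b x : L2_scale a (L2_scale b x) = L2_scale (a * b) x.
Proof. by rewrite -[x]L2_reprK !L2_classZ scalerA. Qed.
Fact L2_scale1 : left_id 1 L2_scale.
Proof. by move=> x; rewrite -[x]L2_reprK L2_classZ scale1r. Qed.
Fact L2_scaleDr : right_distributive L2_scale +%R.
Proof.
move=> a x y; rewrite -[x]L2_reprK -[y]L2_reprK -L2_classD !L2_classZ.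
by rewrite scalerDr L2_classD.
Qed.
Fact L2_scaleDl x : {morph L2_scale^~ x : a b / a + b}.
Proof.
by move=> a b; rewrite -[x]L2_reprK !L2_classZ scalerDl L2_classD.
Qed.

HB.instance Definition _ := GRing.Zmodule_isLmodule.Build R[i] L2_sort
  L2_scaleA L2_scale1 L2_scaleDr L2_scaleDl.

Definition cintegral (f : T -> R[i]) : R[i] :=
  (\int[mu]_t cRe (f t)) +i* (\int[mu]_t cIm (f t)).

Definition cintegrable (f : T -> R[i]) :=
  mu.-integrable setT (EFin \o (cRe \o f)) /\ mu.-integrable setT (EFin \o (cIm \o f)).

Lemma cintegralD f g : cintegrable f -> cintegrable g ->
  cintegral (fun t => f t + g t) = cintegral f + cintegral g.
Proof.
move=> [f1 f2] [g1 g2]; rewrite /cintegral.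
under eq_Rintegral do rewrite raddfD.
under [X in _ +i* X]eq_Rintegral do rewrite raddfD.
by rewrite !RintegralD.
Qed.

Lemma cintegralZ a f : cintegrable f -> cintegral (fun t => a * f t) = a * cintegral f.
Proof.
case: a => a b [f1 f2]; rewrite /cintegral.
have iz (c : R) h : mu.-integrable setT (EFin \o h) ->
    mu.-integrable setT (EFin \o (fun t => c * h t)).
  move=> ih; have := integrableZl measurableT c ih.
  by apply: eq_integrable => // t _; rewrite /= EFinM.
rewrite (_ : (fun t => cRe _) = fun t => a * cRe (f t) + (- b) * cIm (f t)); last first.
  by apply/funext => t; case: (f t) => ? ? /=; rewrite mulNr.
rewrite (_ : (fun t => cIm _) = fun t => a * cIm (f t) + b * cRe (f t)); last first.
  by apply/funext => t; case: (f t) => ? ? /=.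
rewrite !RintegralD ?RintegralZl//; try exact: iz.
by rewrite mulNr.
Qed.

Lemma cintegral_conj f : cintegrable f -> cintegral (fun t => (f t)^*) = (cintegral f)^*.
Proof.
move=> [f1 f2]; rewrite conj_complexE /cintegral /=.
under eq_Rintegral do rewrite conj_complexE /=.
under [X in _ +i* X]eq_Rintegral do rewrite conj_complexE /= -mulN1r.
by rewrite RintegralZl// mulN1r.
Qed.

Lemma cintegral_ae f g : cintegrable f -> cintegrable g ->
  {ae mu, forall t, f t = g t} -> cintegral f = cintegral g.
Proof.
move=> [/measurable_int f1 /measurable_int f2] [/measurable_int g1 /measurable_int g2] fg.
rewrite /cintegral /Rintegral; congr (fine _ +i* fine _).
  by apply: ae_eq_integral => //; apply: filterS fg => t /= ->.
by apply: ae_eq_integral => //; apply: filterS fg => t /= ->.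
Qed.

Lemma L2_cintegrable u v : cintegrable (fun t => u t * (v t)^*).
Proof.
have [/andP[u1 u2] /andP[v1 v2]] := (L2_funP u, L2_funP v).
have H (f g f' g' : T -> R) : f \in Lfun mu 2%:E -> g \in Lfun mu 2%:E ->
    f' \in Lfun mu 2%:E -> g' \in Lfun mu 2%:E ->
    mu.-integrable setT (EFin \o (fun t => f t * g t + f' t * g' t)).
  move=> Lf Lg Lf' Lg'.
  have /Lfun1_integrable i1 := Lfun2_mul_Lfun1 Lf Lg.
  have /Lfun1_integrable i2 := Lfun2_mul_Lfun1 Lf' Lg'.
  by have := integrableD measurableT i1 i2; apply: eq_integrable.
have v2N : (fun t => -1 * cIm (v t) + 0 * cIm (v t)) \in Lfun mu 2%:E by exact: Lfun2_lin.
split.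
  have := H _ _ _ _ u1 v1 u2 v2; apply: eq_integrable => // t _ /=; congr EFin.
  by rewrite conj_complexE; case: (u t) (v t) => ? ? [? ?] /=; rewrite mulrN opprK.
have := H _ _ _ _ u1 v2N u2 v1; apply: eq_integrable => // t _ /=; congr EFin.
by rewrite conj_complexE mulN1r mul0r addr0; case: (u t) (v t).
Qed.

Definition L2_dot (x y : L2_sort) : R[i] :=
  cintegral (fun t => L2_repr x t * (L2_repr y t)^*).

Lemma L2_dotE u v : L2_dot (L2_class u) (L2_class v) = cintegral (fun t => u t * (v t)^*).
Proof.
apply: cintegral_ae; do ?exact: L2_cintegrable.
by apply: filterS2 (L2_classK u) (L2_classK v) => t -> ->.
Qed.

Fact L2_dot_herm x y : L2_dot x y = (-1) ^+ false * (L2_dot y x)^*.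
Proof.
rewrite expr0 mul1r -cintegral_conj; last exact: L2_cintegrable.
rewrite /L2_dot; congr cintegral; apply/funext => t.
have E (a b : R[i]) : a * b^* = (b * a^*)^* by rewrite rmorphM /= conjCK mulrC.
exact: E.
Qed.

Fact L2_dot_linl y : GRing.linear_for *%R (L2_dot^~ y).
Proof.
move=> a x x'; rewrite -[x]L2_reprK -[x']L2_reprK -[y]L2_reprK.
rewrite -[a *: _]/(L2_scale a _) L2_classZ -L2_classD !L2_dotE.
rewrite -cintegralZ; last exact: L2_cintegrable.
rewrite -cintegralD; last 2 first.
- have := L2_cintegrable (a *: L2_repr x) (L2_repr y); congr cintegrable.
  by apply/funext => t; rewrite mulrA.
- exact: L2_cintegrable.
congr cintegral; apply/funext => t; rewrite mulrA -mulrDl.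
by [].
Qed.

Fact L2_dot_bilin : bilinear_for *%R ((Num.conj : R[i] -> R[i]) \; *%R) L2_dot.
Proof.
split=> [|u a v w]; first exact: L2_dot_linl.
have hC x y : L2_dot x y = (L2_dot y x)^* by rewrite L2_dot_herm mul1r.
by rewrite hC L2_dot_linl rmorphD rmorphM /= -!hC.
Qed.

Fact L2_dot_gt0 x : x != 0 -> 0 < L2_dot x x.
Proof.
move=> x0; rewrite /L2_dot; set u := L2_repr x.
have sqE t : u t * (u t)^* = (cRe (u t) ^+ 2 + cIm (u t) ^+ 2)%:C.
  rewrite conj_complexE; case: (u t) => a b /=; apply/eqP.
  by rewrite eq_complex /=; apply/andP; split; apply/eqP; ring.
have [iu _] := L2_cintegrable u u.
have -> : cintegral (fun t => u t * (u t)^*) =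
    (\int[mu]_t (cRe (u t) ^+ 2 + cIm (u t) ^+ 2))%:C.
  rewrite /cintegral; apply/eqP; rewrite eq_complex /=; apply/andP; split; apply/eqP.
    by apply: eq_Rintegral => t _; rewrite sqE.
  rewrite (_ : (fun t => cIm _) = cst 0); last by apply/funext => t; rewrite sqE.
  by rewrite Rintegral_cst// mul0r.
have sq0 t : 0 <= cRe (u t) ^+ 2 + cIm (u t) ^+ 2 by rewrite addr_ge0 ?sqr_ge0.
have iu' : mu.-integrable setT (EFin \o (fun t => cRe (u t) ^+ 2 + cIm (u t) ^+ 2)).
  by apply: eq_integrable iu => // t _; rewrite /= sqE.
rewrite ltcR lt_neqAle Rintegral_ge0 ?andbT//.
apply: contra x0 => /eqP u0; apply/eqP; rewrite -[x]L2_reprK -L2_class0.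
apply/L2_classP.
have : (\int[mu]_t `|(cRe (u t) ^+ 2 + cIm (u t) ^+ 2)%:E| = 0)%E.
  under eq_integral do rewrite gee0_abs ?lee_fin//.
  rewrite -(@fineK _ (\int[mu]_t _)%E); last exact: integrable_fin_num.
  by rewrite -[fine _]/(\int[mu]_t _)%R -u0.
move=> /(ae_eq_integral_abs mu measurableT (measurable_int mu iu')).
apply: filterS => t /(_ I) [] /eqP.
rewrite paddr_eq0 ?sqr_ge0// !sqrf_eq0 => h.
by apply/eqP; rewrite eq_complex.
Qed.

HB.instance Definition _ := bilinear_isBilinear.Build R[i] L2_sort L2_sort R[i]
  *%R (Num.conj \; *%R) L2_dot L2_dot_bilin.
HB.instance Definition _ := isHermitianSesquilinear.Build R[i] L2_sort
  false Num.conj L2_dot L2_dot_herm.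
HB.instance Definition _ := isDotProduct.Build R[i] L2_sort L2_dot L2_dot_gt0.

Definition L2 : prehilbert R := @PreHilbert R L2_sort L2_dot.

End L2.

Section Operators.
Variables (R : realType) (H : prehilbert R).

(* A possibly unbounded operator is given by its graph; its domain is the
   projection of the graph. *)
Definition operator := set (H * H).

Definition op_id : operator := [set xy | xy.2 = xy.1].

Definition op_add (A B : operator) : operator :=
  [set xy | exists u v, [/\ A (xy.1, u), B (xy.1, v) & xy.2 = u + v]].

Definition op_comp (A B : operator) : operator :=
  [set xy | exists2 z, B (xy.1, z) & A (z, xy.2)].

(* The functional calculus phi(A) for a selfadjoint operator A whose
   eigenvectors span a dense subspace (for instance, A with compact resolvent):
   phi(A) is the selfadjoint operator that multiplies each eigenvector of
   eigenvalue l by phi(l), i.e. the adjoint of its restriction to the span of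
   the eigenvectors. If the eigenvectors of A do not span a dense subspace, the
   graph below is not single-valued. *)
Definition op_fun (phi : R -> R) (A : operator) : operator :=
  [set xy | forall (v : H) (l : R), A (v, l%:C *: v) ->
     '<xy.2, v> = (phi l)%:C * '<xy.1, v> ].

Definition orthonormal_basis (I : choiceType) (e : I -> H) : Prop :=
  (forall i j, '<e i, e j> = (i == j)%:R) /\
  (forall (x : H) (eps : R), 0 < eps ->
     exists (s : seq I) (c : I -> R[i]), normsq (x - \sum_(i <- s) c i *: e i) < eps).

(* The trace of an everywhere defined positive operator: all orthonormal bases
   give the same value. *)
Definition trace (A : H -> H) : \bar R :=
  ereal_sup [set t | exists (I : choiceType) (e : I -> H),
    orthonormal_basis e /\ t = \esum_(i in [set: I]) (cRe '<A (e i), e i>)%:E].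

Definition op_summable (D : operator) (p : R) : Prop :=
  exists A : H -> H,
    (forall x y,
       op_fun (fun t => t `^ (- p / 2)) (op_add op_id (op_comp D D)) (x, y)
         <-> y = A x) /\
    (trace A < +oo)%E.

End Operators.

Definition op_dsum (R : realType) (I : choiceType) (H : I -> prehilbert R)
    (A : forall i, operator (H i)) : operator (dsum H) :=
  [set xy | forall i, A i (fam xy.1 i, fam xy.2 i)].

Definition L2_mul (d : measure_display) (T : measurableType d) (R : realType)
    (mu : {measure set T -> \bar R}) (a : T -> R[i]) : operator (L2 mu) :=
  [set xy | exists f g : L2fun mu,
    [/\ xy.1 = L2_class f, xy.2 = L2_class g &
        {ae mu, forall t, g t = a t * f t}]].
Arguments L2_mul {d T R} mu a.

Section Arc.
Variables (R : realType) (r : {posnum R}).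

Fact arc_density_ge0 : 0 <= (2 * pi * r%:num)^-1 :> R.
Proof. by rewrite invr_ge0 !mulr_ge0// pi_ge0. Qed.

(* dx / (2 pi r) on [- pi r, pi r], as a measure on R. *)
Definition arc_measure : {measure set (measurableTypeR R) -> \bar R} :=
  mscale (NngNum arc_density_ge0)
    (mrestr lebesgue_measure (measurable_itv `[- (pi * r%:num), pi * r%:num])).

Lemma arc_measure_setT : arc_measure setT = 1%E.
Proof.
rewrite /arc_measure /= /mscale /= {1}/mrestr setTI lebesgue_measure_itv /= lte_fin.
have pr : 0 < pi * r%:num :> R by rewrite mulr_gt0// pi_gt0.
rewrite ifT; last by rewrite (@lt_trans _ _ 0)// oppr_lt0.
rewrite -EFinB -EFinM opprK; congr EFin.
by rewrite -mulrA -mulr2n -(mulr_natl (pi * _)) mulVf// mulf_neq0// gt_eqF.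
Qed.

Definition expo (l : int) (x : R) : R[i] :=
  cos (l%:~R * x / r%:num) +i* sin (l%:~R * x / r%:num).

Fact bounded_Lfun2 (f : R -> R) : measurable_fun setT f -> (forall x, `|f x| <= 1) ->
  (f : measurableTypeR R -> R) \in Lfun arc_measure 2%:E.
Proof.
move=> mf f1; rewrite inE; apply/andP; split; rewrite inE//=.
rewrite /finite_norm unlock; apply: poweR_lty.
apply: (@le_lt_trans _ _ (\int[arc_measure]_x 1)%E); last first.
  by rewrite integral_cst// mul1e arc_measure_setT ltry.
apply: ge0_le_integral => //.
- by move=> x _; rewrite poweR_ge0.
- apply/measurable_EFinP; apply: (measurableT_comp (measurable_powR _)).
  exact: measurableT_comp.
- move=> x _ /=; rewrite lee_fin.
  rewrite [leRHS](_ : _ = 1 `^ 2); last by rewrite powR1.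
  by apply: (@ge0_ler_powR R 2); rewrite ?nnegrE.
Qed.

Fact expo_L2 l : expo l \in L2_pred arc_measure.
Proof.
have mlin : measurable_fun setT (fun x : R => l%:~R * x / r%:num).
  by apply: measurable_funM => //; exact: measurable_funM.
rewrite inE; apply/andP; split; apply: bounded_Lfun2 => [|x].
- by apply: measurableT_comp mlin; apply: continuous_measurable_fun; exact: continuous_cos.
- by rewrite ler_norml cos_geN1 cos_le1.
- by apply: measurableT_comp mlin; apply: continuous_measurable_fun; exact: continuous_sin.
- by rewrite ler_norml sin_geN1 sin_le1.
Qed.

Definition basis_vec (l : int) : L2 arc_measure := L2_class (L2Fun (expo_L2 l)).

(* The adjoint of the operator e^{ilx/r} |-> (l + 1/2) / r e^{ilx/r} on the
   trigonometric polynomials, hence the selfadjoint operator determined by these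
   values, the functions e^{ilx/r} being an orthonormal basis of L2. *)
Definition arc_dirac : operator (L2 arc_measure) :=
  [set xy | forall l : int,
    '<xy.2, basis_vec l> = ((l%:~R + 2^-1) / r%:num)%:C * '<xy.1, basis_vec l> ].

End Arc.

Section Triangles.
Variable R : realType.

(* The equilateral triangle of circumference 2 pi radius with a horizontal side;
   its lowest (lowest left, if it points upwards) vertex is anchor. *)
Record triangle := Triangle {
  anchor : R * R;
  radius : {posnum R};
  upward : bool }.

Definition side (T : triangle) : R := 2 * pi * (radius T)%:num / 3.

(* Counterclockwise, starting from the anchor. *)
Definition vertex (T : triangle) (k : nat) : R * R :=
  let: (x, y) := anchor T in
  let s := side T in
  let h := Num.sqrt 3 / 2 * s in
  match k with
  | 0 => (x, y)
  | 1 => if upward T then (x + s, y) else (x + s / 2, y + h)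
  | _ => if upward T then (x + s / 2, y + h) else (x - s / 2, y + h)
  end.

Definition segment (p q : R * R) (t : R) : R * R :=
  (p.1 + t * (q.1 - p.1), p.2 + t * (q.2 - p.2)).

Definition boundary_param (T : triangle) (x : R) : R * R :=
  let t := (x + pi * (radius T)%:num) / side T in
  if t <= 1 then segment (vertex T 0) (vertex T 1) t
  else if t <= 2 then segment (vertex T 1) (vertex T 2) (t - 1)
  else segment (vertex T 2) (vertex T 0) (t - 2).

Definition solid (T : triangle) : set (R * R) :=
  [set p | exists a b c : R, [/\ 0 <= a, 0 <= b, 0 <= c, a + b + c = 1 &
    p = (a * (vertex T 0).1 + b * (vertex T 1).1 + c * (vertex T 2).1,
         a * (vertex T 0).2 + b * (vertex T 1).2 + c * (vertex T 2).2)]].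

Definition midpoint (p q : R * R) : R * R := segment p q 2^-1.

Definition corner (T : triangle) (k : nat) : triangle :=
  Triangle (midpoint (vertex T 0) (vertex T k)) ((radius T)%:num / 2)%:pos true.

Definition middle (T : triangle) : triangle :=
  Triangle (midpoint (vertex T 0) (vertex T 1)) ((radius T)%:num / 2)%:pos false.

Definition Delta01 : triangle := Triangle (0, 0) 1%:pos true.

(* The 3 ^ n solid triangles that remain after n steps. *)
Fixpoint cells (n : nat) : seq triangle :=
  if n is n'.+1 then flatten [seq [seq corner T k | k <- iota 0 3] | T <- cells n']
  else [:: Delta01].

Fixpoint gasket_step (n : nat) : set (R * R) :=
  if n is n'.+1 then
    gasket_step n' `\` [set p | exists2 T, List.In T (cells n') & (solid (middle T))° p]
  else solid Delta01.

Definition gasket : set (R * R) := \bigcap_n gasket_step n.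

Record cont_gasket := ContGasket {
  cont_fun :> R * R -> R[i];
  cont_Re : {within gasket, continuous (cRe \o cont_fun)};
  cont_Im : {within gasket, continuous (cIm \o cont_fun)} }.

Record fredholm_module := FredholmModule {
  fm_space : prehilbert R;
  fm_rep : cont_gasket -> operator fm_space;
  fm_dirac : operator fm_space }.

Definition fm_dsum (I : choiceType) (M : I -> fredholm_module) : fredholm_module :=
  FredholmModule (fun a => op_dsum (fun i => @fm_rep (M i) a))
                 (op_dsum (fun i => @fm_dirac (M i))).

Definition fm_add (M N : fredholm_module) : fredholm_module :=
  fm_dsum (fun b : bool => if b then M else N).

Definition fm_curve (r : {posnum R}) (rho : R -> R * R) : fredholm_module :=
  FredholmModule (fun a => L2_mul (arc_measure r) (fun x => a (rho x)))
                 (@arc_dirac R r).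

Definition UFM (T : triangle) : fredholm_module :=
  fm_curve (radius T) (boundary_param T).

Definition UFMbar (T : triangle) : fredholm_module :=
  fm_curve (radius T) (fun x => boundary_param T (- x)).

Definition fm_summable (M : fredholm_module) (p : R) : Prop :=
  op_summable (@fm_dirac M) p.

End Triangles.

Definition HSG : Type :=
  {mk : nat * nat | [&& 1 <= mk.1, 1 <= mk.2 & mk.2 <= 3 ^ (mk.1 - 1)]%N}.
HB.instance Definition _ := Choice.on HSG.

Section Gasket.
Variable R : realType.

Definition nabla (x : HSG) : triangle R :=
  let: (m, k) := val x in middle (nth (Delta01 R) (cells R (m - 1)) (k - 1)).

Definition ZGT : fredholm_module R :=
  fm_add (UFMbar (Delta01 R)) (fm_dsum (fun x : HSG => UFM (nabla x))).

(* The index type has `|f x| elements over x, none if f x = 0. *)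
Definition UFMf (f : HSG -> int) : fredholm_module R :=
  fm_dsum (fun i : {x : HSG & 'I_(`|f x|%N)} =>
    if 0 < f (tag i) then UFM (nabla (tag i)) else UFMbar (nabla (tag i))).

Definition ST (f : HSG -> int) : fredholm_module R := fm_add ZGT (UFMf f).

End Gasket.

(* Main.v *)
(** The Dirac operator of [ST f] is diagonal in an orthonormal basis: on a triangle
    of circumference [2 pi r] the basis is [e^(ilx/r)], [l : int], with eigenvalues
    [(l + 1/2) / r], and a direct sum of diagonal operators is diagonal in the union
    of the bases. If [e_i] is such a basis with eigenvalues [lam_i], then
    [(1 + D^2)^(-p/2)] is the multiplier by [(1 + lam_i^2)^(-p/2)], and its trace in
    any orthonormal basis is at most the sum of these numbers, by Parseval for one
    basis and Bessel for the other. On one triangle [1 + lam_l^2] is at least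
    [(n / 2r)^2], where [n = 1, 2, ...] takes every value for two indices [l], so the
    sum is at most a constant times [(2r)^p], as [p > 1]. There are [3^(m-1)]
    triangles of radius [2^-m], each used a bounded number of times, and
    [sum_m 3^m 2^(-pm)] is finite since [2^p > 3].

    Completeness of the exponentials is proved through indicators: polynomials in
    [cos (x - a)] converge boundedly to the indicator of an arc, arcs give rays up to
    a null set, and rays generate the Borel sets. *)

Require Import Defs.
From mathcomp Require Import all_boot all_order all_algebra.
From mathcomp Require Import all_classical all_reals all_analysis measurable_realfun.
From mathcomp Require Import complex zify ring lra.

Set Implicit Arguments.
Unset Strict Implicit.
Unset Printing Implicit Defensive.

Import Order.TTheory GRing.Theory Num.Theory.
Import numFieldNormedType.Exports.

Local Open Scope classical_set_scope.
Local Open Scope complex_scope.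
Local Open Scope ring_scope.

Local Notation cRe := (@complex.Re _).
Local Notation cIm := (@complex.Im _).
Local Notation rad T := (Defs.radius T)%:num.

(** * Sums and orthonormal families *)

Section EsumSigma.
Variables (R : realType) (I : choiceType) (J : I -> choiceType).

(** Two reindexings: k |-> (tag k, k) turns the sum into one over the graph of [tag], and the fibre
    of [tag] over i is a copy of [J i]. *)
Lemma esum_sigma (a : {i : I & J i} -> \bar R) : (forall k, 0 <= a k)%E ->
  (\esum_(k in [set: {i : I & J i}]) a k =
   \esum_(i in [set: I]) \esum_(j in [set: J i]) a (Tagged J j))%E.
Proof.
move=> a0.
transitivity (\esum_(i in [set: I]) \esum_(k in [set k : {i : I & J i} | tag k = i]) a k)%E.
  rewrite esum_esum// (@reindex_esum _ _ _ [set: {i : I & J i}] _ (fun k => (tag k, k)))//.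
  split=> [k _ //|k l _ _ []//|[i k] [_ /= <-]].
  by exists k.
apply: eq_esum => i _.
rewrite (@reindex_esum _ _ _ [set: J i] _ (fun j => Tagged J j))//.
split=> [j _ //|j l _ _ /eqP|[i' k] /= ik]; first by rewrite -tag_eqE /tag_eq /= eqxx tagged_asE => /eqP.
by subst i'; exists k.
Qed.

End EsumSigma.

Section EsumReal.
Variables (R : realType) (I : choiceType).
Implicit Types u : I -> R.

Lemma esum_le_finite u (c : \bar R) :
  (forall s : seq I, uniq s -> ((\sum_(i <- s) u i)%:E <= c)%E) ->
  (\esum_(i in [set: I]) (u i)%:E <= c)%E.
Proof.
move=> h; apply: ge_ereal_sup => _ [A [finA _] <-].
by rewrite fsbig_finite//= sumEFin h// fset_uniq.
Qed.

Lemma finite_le_esum u (s : seq I) : (forall i, 0 <= u i) -> uniq s ->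
  ((\sum_(i <- s) u i)%:E <= \esum_(i in [set: I]) (u i)%:E)%E.
Proof.
move=> u0 us; apply: esum_ge; exists [set` s]; first by split => //; exact: finite_seq.
by rewrite -sumEFin -fsbig_seq.
Qed.

Lemma esum_gt_finite u (x : R) : (x%:E < \esum_(i in [set: I]) (u i)%:E)%E ->
  exists2 s : seq I, uniq s & x < \sum_(i <- s) u i.
Proof.
move=> /ereal_sup_gt[_ [A [finA _] <-]].
rewrite fsbig_finite//= sumEFin lte_fin => h.
by exists (finmap.enum_fset (fset_set A)) => //; exact: finmap.fset_uniq.
Qed.

End EsumReal.

Section ComplexSquare.
Variable R : realType.
Implicit Types z w : R[i].

Definition sqc z : R := cRe z ^+ 2 + cIm z ^+ 2.

Lemma sqc_ge0 z : 0 <= sqc z. Proof. by rewrite addr_ge0 ?sqr_ge0. Qed.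
Lemma sqc0 : sqc 0 = 0. Proof. by rewrite /sqc /= expr0n addr0. Qed.
Lemma sqcM z w : sqc (z * w) = sqc z * sqc w.
Proof. by case: z w => a b [c d]; rewrite /sqc /=; ring. Qed.
Lemma sqc_conj z : sqc z^* = sqc z.
Proof. by rewrite conj_complexE /sqc /= sqrrN. Qed.
Lemma sqc_real (c : R) : sqc c%:C = c ^+ 2.
Proof. by rewrite /sqc /= expr0n addr0. Qed.
Lemma sqcN z : sqc (- z) = sqc z.
Proof. by rewrite /sqc !raddfN /= !sqrrN. Qed.
Lemma mulr_conj z : z * z^* = (sqc z)%:C.
Proof.
rewrite conj_complexE /sqc; case: z => a b /=; apply/eqP; rewrite eq_complex /=.
by apply/andP; split; apply/eqP; ring.
Qed.
Lemma sqc_eq0 z : (sqc z == 0) = (z == 0).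
Proof.
by rewrite paddr_eq0 ?sqr_ge0// !sqrf_eq0 eq_complex.
Qed.

End ComplexSquare.

Section Orthonormal.
Variables (R : realType) (H : prehilbert R).
Implicit Types (x y v w : H).

Lemma dot0l v : '<(0 : H), v> = 0. Proof. exact: linear0l. Qed.

Lemma dotBl u v w : '<u - v, w> = '<u, w> - '<v, w> :> R[i].
Proof. by rewrite dotDl -scaleN1r dotZl mulN1r. Qed.

Lemma dot_suml (I : Type) (s : seq I) (F : I -> H) v :
  '<\sum_(i <- s) F i, v> = \sum_(i <- s) '<F i, v>.
Proof. by elim/big_ind2: _ => [|x a y b <- <-//|//]; rewrite ?dot0l// dotDl. Qed.

Lemma dot_sumr (I : Type) (s : seq I) (F : I -> H) v :
  '<v, \sum_(i <- s) F i> = \sum_(i <- s) '<v, F i>.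
Proof. by rewrite dotC dot_suml rmorph_sum/=; apply: eq_bigr => i _; rewrite -dotC. Qed.

(* The discriminant of t |-> |x + t y|^2. *)
Lemma Re_dot_sqr_le x y : cRe '<x, y> ^+ 2 <= normsq x * normsq y.
Proof.
have [y0|y0] := eqVneq (normsq y) 0.
  by rewrite (normsq_eq0 y0) -[0 in leLHS](scale0r (0 : H)) dotZr rmorph0 mul0r /= expr0n mulr_ge0 ?normsq_ge0.
have yp : 0 < normsq y by rewrite lt_neqAle eq_sym y0 normsq_ge0.
have := normsq_ge0 (x + (- (cRe '<x, y> / normsq y))%:C *: y).
rewrite normsqD normsqZ dotZr conj_complexE.
set c := cRe '<x, y> / normsq y.
have cE : cRe '<x, y> = c * normsq y by rewrite divfK.
have -> : cRe (((cRe (- c)%:C) -i* (cIm (- c)%:C)) * '<x, y>) = - c * cRe '<x, y>.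
  by case: '<x, y> => a b /=; ring.
rewrite /= cE => h.
suff : 0 <= normsq x - c ^+ 2 * normsq y.
  rewrite -(pmulr_lge0 _ yp) -[_ <= normsq x * _]subr_ge0.
  by have -> : normsq x * normsq y - (c * normsq y) ^+ 2 = (normsq x - c ^+ 2 * normsq y) * normsq y by ring.
by move: h; rewrite expr0n /= addr0 mulr2n; lra.
Qed.

(** The density clause of [orthonormal_basis] says that every vector lies here; as there, [s] may
    repeat indices. *)
Definition closed_span (I : choiceType) (e : I -> H) : set H :=
  [set x | forall eps : R, 0 < eps ->
     exists (s : seq I) (c : I -> R[i]), normsq (x - \sum_(i <- s) c i *: e i) < eps].

Variables (I : choiceType) (e : I -> H).

(** Repeated indices merge when the coefficient is multiplied by the multiplicity. The projection
    formulas below need duplicate-free index lists. *)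
Lemma span_undup (s : seq I) (c : I -> R[i]) : exists c' : I -> R[i],
  \sum_(i <- s) c i *: e i = \sum_(i <- undup s) c' i *: e i.
Proof.
exists (fun i => c i *+ count_mem i s).
rewrite -big_undup_iterop_count; apply: eq_bigr => i _.
by rewrite -scalerMnl Monoid.iteropE; elim: (count_mem i s) => //= n ->; rewrite mulrS.
Qed.

Lemma closed_span_limit (x : H) :
  (forall eps : R, 0 < eps -> exists2 y, closed_span e y & normsq (x - y) < eps) ->
  closed_span e x.
Proof.
(* Quarters of eps absorb the factor 2 of [normsqD_le]. *)
move=> h eps eps0; have [|y ye xy] := h (eps / 4); first by rewrite divr_gt0.
have [|s [c ysc]] := ye (eps / 4); first by rewrite divr_gt0.
exists s, c; rewrite -(subrKA y).
by apply: le_lt_trans (normsqD_le _ _) _; rewrite mulr2n; lra.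
Qed.

Lemma closed_span_basis i : closed_span e (e i).
Proof. by move=> eps eps0; exists [:: i], (fun=> 1); rewrite big_seq1 scale1r subrr normsq0. Qed.

Lemma closed_spanZ (a : R[i]) (x : H) : closed_span e x -> closed_span e (a *: x).
Proof.
move=> xe eps eps0.
have a1 : 0 < sqc a + 1 by rewrite ltr_wpDl ?sqc_ge0.
have [|s [c xsc]] := xe (eps / (sqc a + 1)); first by rewrite divr_gt0.
exists s, (fun i => a * c i).
under eq_bigr do rewrite -scalerA.
rewrite -scaler_sumr -scalerBr normsqZ -/(sqc a).
move: xsc; rewrite ltr_pdivlMr// mulrC mulrDl mul1r; apply: le_lt_trans.
by rewrite lerDl normsq_ge0.
Qed.

Lemma closed_spanD (x y : H) : closed_span e x -> closed_span e y -> closed_span e (x + y).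
Proof.
move=> xe ye eps eps0.
have [|s [c xsc]] := xe (eps / 4); first by rewrite divr_gt0.
have [|t [d ytd]] := ye (eps / 4); first by rewrite divr_gt0.
have [c' cE] := span_undup s c; have [d' dE] := span_undup t d.
(* Both combinations are extended by zero to a common duplicate-free list, on which their
   coefficients add. *)
pose u := undup (s ++ t).
exists u, (fun i => (if i \in s then c' i else 0) + (if i \in t then d' i else 0)).
have E (r : seq I) (f : I -> R[i]) : {subset r <= u} ->
    \sum_(i <- u) (if i \in r then f i else 0) *: e i = \sum_(i <- undup r) f i *: e i.
  move=> ru; rewrite (bigID (mem r)) /= [X in _ + X]big1 ?addr0; last first.
    by move=> i /negPf ->; rewrite scale0r.
  rewrite -big_filter (perm_big (undup r)).
    by rewrite !big_seq; apply: eq_bigr => i; rewrite mem_undup => ->.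
  apply: uniq_perm; rewrite ?filter_uniq ?undup_uniq// => i.
  rewrite mem_filter mem_undup; case: (boolP (i \in r)) => // /ru.
  by rewrite mem_undup.
under eq_bigr do rewrite scalerDl.
rewrite big_split /= !E; last 2 first.
- by move=> i it; rewrite mem_undup mem_cat it orbT.
- by move=> i it; rewrite mem_undup mem_cat it.
rewrite -cE -dE opprD addrACA.
by apply: le_lt_trans (normsqD_le _ _) _; rewrite mulr2n; lra.
Qed.

Hypothesis e_orth : forall i j, '<e i, e j> = (i == j)%:R.

(** The square is completed one vector at a time: by orthogonality, removing one term leaves the
    other coefficients unchanged. The last sum vanishes for the Fourier coefficients of [x], which
    therefore minimise the distance. *)
Lemma normsq_sub_span (s : seq I) (c : I -> R[i]) x : uniq s ->
  normsq (x - \sum_(i <- s) c i *: e i) =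
  normsq x - \sum_(i <- s) sqc '<x, e i> + \sum_(i <- s) sqc ('<x, e i> - c i).
Proof.
elim: s x => [|j s IH] x /=; first by rewrite !big_nil !subr0 addr0.
move=> /andP[js us]; rewrite !big_cons opprD addrA IH//.
have E i : i \in s -> '<x - c j *: e j, e i> = '<x, e i>.
  move=> si; rewrite dotBl dotZl e_orth (_ : (j == i) = false) ?mulr0 ?subr0//.
  by apply: contraNF js => /eqP ->.
rewrite !big_seq; under eq_bigr => i si do rewrite E//.
under [X in _ + X = _]eq_bigr => i si do rewrite E//.
have -> : normsq (x - c j *: e j) =
    normsq x - sqc '<x, e j> + sqc ('<x, e j> - c j).
  rewrite -scaleNr normsqD normsqZ dotZr.
  have -> : normsq (e j) = 1 by rewrite /normsq e_orth eqxx.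
  rewrite conj_complexE /sqc mulr1; case: '<x, e j> (c j) => a b [a' b'] /=; ring.
by ring.
Qed.

Lemma bessel (s : seq I) x : uniq s -> \sum_(i <- s) sqc '<x, e i> <= normsq x.
Proof.
move=> us; have := normsq_ge0 (x - \sum_(i <- s) '<x, e i> *: e i).
rewrite normsq_sub_span// [X in _ + X]big1 ?addr0 ?subr_ge0//.
by move=> i _; rewrite subrr sqc0.
Qed.

Lemma bessel1 i x : sqc '<x, e i> <= normsq x.
Proof. by have := @bessel [:: i] x erefl; rewrite big_seq1. Qed.

Lemma bessel_esum x : (\esum_(i in [set: I]) (sqc '<x, e i>)%:E <= (normsq x)%:E)%E.
Proof. by apply: esum_le_finite => s us; rewrite lee_fin bessel. Qed.

Definition parseval := forall x,
  (normsq x)%:E = (\esum_(i in [set: I]) (sqc '<x, e i>)%:E)%E.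

(** By [normsq_sub_span], any combination within eps of [x] (in squared norm) forces the sum of the
    squared coefficients over its indices above |x|^2 - eps. *)
Lemma closed_span_parseval : (forall x, closed_span e x) -> parseval.
Proof.
move=> ex x; apply/le_anti; rewrite bessel_esum andbT.
apply/lee_addgt0Pr => eps eps0; have [s [c xsc]] := ex x eps eps0.
have [c' cE] := span_undup s c; move: xsc; rewrite cE normsq_sub_span ?undup_uniq// => xsc.
apply: (@le_trans _ _ ((\sum_(i <- undup s) sqc '<x, e i>)%:E + eps%:E)%E).
  rewrite -EFinD lee_fin.
  have : 0 <= \sum_(i <- undup s) sqc ('<x, e i> - c' i).
    by apply: sumr_ge0 => i _; exact: sqc_ge0.
  by move: xsc; lra.
by apply: leeD2r; apply: finite_le_esum; rewrite ?undup_uniq// => i; exact: sqc_ge0.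
Qed.

Hypothesis e_parseval : parseval.

Lemma parseval_approx x (eps : R) : 0 < eps -> exists2 s : seq I, uniq s &
  normsq (x - \sum_(i <- s) '<x, e i> *: e i) < eps.
Proof.
move=> eps0; have := e_parseval x => xE.
have : ((normsq x - eps)%:E < \esum_(i in [set: I]) (sqc '<x, e i>)%:E)%E.
  by rewrite -e_parseval lte_fin ltrBlDr ltrDl.
move=> /esum_gt_finite[s us h]; exists s => //.
rewrite normsq_sub_span// [X in _ + X]big1 ?addr0; first by move: h; lra.
by move=> i _; rewrite subrr sqc0.
Qed.

Lemma coef_inj x y : (forall i, '<x, e i> = '<y, e i>) -> x = y.
Proof.
move=> xy; apply/eqP; rewrite -subr_eq0; apply/eqP/normsq_eq0/EFin_inj.
by rewrite e_parseval esum1// => i _; rewrite dotBl xy subrr sqc0.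
Qed.

Lemma normsq_le_coef x y : (forall i, sqc '<x, e i> <= sqc '<y, e i>) ->
  normsq x <= normsq y.
Proof. by move=> xy; rewrite -lee_fin !e_parseval; apply: le_esum => i _; rewrite lee_fin. Qed.

(* By Cauchy-Schwarz, [x] may be replaced by a partial sum of its expansion. *)
Lemma Re_dot_le_esum x y (u : I -> R) : (forall i, 0 <= u i) ->
  (forall i, cRe ('<y, e i> * '<x, e i>^*) <= u i) ->
  ((cRe '<y, x>)%:E <= \esum_(i in [set: I]) (u i)%:E)%E.
Proof.
move=> u0 yxu; apply/lee_addgt0Pr => eps eps0.
have y1 : 0 < normsq y + 1 by rewrite ltr_wpDl ?normsq_ge0.
(* Chosen so that Cauchy-Schwarz bounds |Re <y, x - S>| by eps; the added 1 covers y = 0. *)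
have d0 : 0 < eps ^+ 2 / (normsq y + 1) by rewrite divr_gt0// exprn_gt0.
have [s us xs] := parseval_approx x d0.
set S := \sum_(i <- s) _ in xs.
rewrite -(subrK S x) dotDr raddfD /= addrC.
apply: (@le_trans _ _ ((\sum_(i <- s) u i)%:E + eps%:E)%E); last first.
  by apply: leeD2r; exact: finite_le_esum.
rewrite -EFinD lee_fin lerD//.
  rewrite dot_sumr raddf_sum /=; apply: ler_sum => i _.
  by rewrite dotZr mulrC.
have := Re_dot_sqr_le y (x - S); move: xs; rewrite ltr_pdivlMr// => xs h.
apply: le_trans (ler_norm _) _; rewrite -(ler_pXn2r (n := 2)) ?nnegrE//; last exact: ltW.
rewrite -normrX ger0_norm ?sqr_ge0//; apply: le_trans h _.
rewrite mulrC; apply: ltW; apply: le_lt_trans xs.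
by rewrite mulrDr mulr1 lerDl normsq_ge0.
Qed.

(** [Re_dot_le_esum] with zero bounds applies to every multiple of [y]; for the multiple by the
    conjugate of <y, x> it reads |<y, x>|^2 <= 0. *)
Lemma dot_eq0_coef x y : (forall i, '<y, e i> * '<x, e i>^* = 0) -> '<y, x> = 0.
Proof.
move=> yx.
have H0 (z : R[i]) : cRe '<z *: y, x> <= 0.
  have := @Re_dot_le_esum x (z *: y) (fun=> 0) (fun=> lexx _).
  rewrite esum1// lee_fin; apply => i.
  by rewrite dotZl -mulrA yx mulr0.
have := H0 ('<y, x>^*); rewrite dotZl mulrC mulr_conj /= => h.
by apply/eqP; rewrite -sqc_eq0; apply/eqP/le_anti; rewrite h sqc_ge0.
Qed.

End Orthonormal.

(** * Diagonal operators *)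

(** [diag_phi] is a field because [prehilbert] does not include completeness: the vector with the
    multiplied coefficients has to be produced for each space. The cost is an upper bound rather
    than a value, so that estimates pass through direct sums. *)
Record diagonalization (R : realType) (phi : R -> R) (H : prehilbert R) (D : operator H)
    (c : \bar R) := Diagonalization {
  diag_idx : choiceType;
  diag_vec : diag_idx -> H;
  diag_val : diag_idx -> R;
  diag_orth : forall i j, '<diag_vec i, diag_vec j> = (i == j)%:R;
  diag_parseval : parseval diag_vec;
  diag_graph : forall x y, D (x, y) <->
    forall i, '<y, diag_vec i> = (diag_val i)%:C * '<x, diag_vec i>;
  diag_phi : forall x, exists y, forall i,
    '<y, diag_vec i> = (phi (diag_val i))%:C * '<x, diag_vec i>;
  diag_cost : (\esum_(i in [set: diag_idx]) (phi (diag_val i))%:E <= c)%E }.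

Definition spectral_weight (R : realType) (p t : R) : R := (1 + t ^+ 2) `^ (- p / 2).

Section DiagonalSummable.
Variables (R : realType) (H : prehilbert R) (D : operator H).

(** [op_fun] tests against all eigenvectors of 1 + D^2. One direction takes the test vector [e i].
    For the other, an eigenvector [v] of eigenvalue [l] has coefficient 0 at each i with 1 + lam_i^2
    <> l, so on the coefficients of [v] the multiplier acts as phi l. *)
Lemma op_fun_diagonal (phi : R -> R) (I : choiceType) (e : I -> H) (lam : I -> R) :
  (forall i j, '<e i, e j> = (i == j)%:R) -> parseval e ->
  (forall x y, D (x, y) <-> forall i, '<y, e i> = (lam i)%:C * '<x, e i>) ->
  forall x y, op_fun phi (op_add (@op_id _ H) (op_comp D D)) (x, y) <->
    forall i, '<y, e i> = (phi (1 + lam i ^+ 2))%:C * '<x, e i>.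
Proof.
move=> eo ep De x y; split=> [h i|h v l /=].
  apply: h; exists (e i), ((lam i ^+ 2)%:C *: e i); split => //=.
    exists ((lam i)%:C *: e i); apply/De => j; rewrite dotZl eo.
      by have [->//|_] := eqVneq i j; rewrite !mulr0.
    rewrite dotZl eo.
    by have [->|_] := eqVneq i j; rewrite ?mulr0// !mulr1 rmorphXn.
  by rewrite rmorphD rmorph1 scalerDl scale1r.
move=> [u [w [/= uv [z /De Dvz /De Dzw] vE]]]; rewrite /op_id /= in uv; subst u.
apply/eqP; rewrite -subr_eq0 -dotZl -dotBl; apply/eqP.
apply: (dot_eq0_coef eo ep) => i.
rewrite dotBl dotZl h.
(* Comparing coefficients at [i] gives (l - (1 + lam_i^2)) <v, e_i> = 0. *)
have : '<l%:C *: v, e i> = '<v + w, e i> by rewrite vE.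
rewrite dotDl dotZl Dzw Dvz mulrA -rmorphM -[X in _ = X + _]mul1r -mulrDl.
rewrite -[1 in X in X -> _]/(1%:C) -rmorphD => /eqP.
rewrite -subr_eq0 -mulrBl mulf_eq0 -rmorphB => /orP[|/eqP->].
  rewrite eq_complex /= eqxx andbT subr_eq0 => /eqP ->.
  by rewrite -expr2 subrr mul0r.
by rewrite rmorph0 mulr0.
Qed.

Lemma diagonal_summable (p : R) (c : \bar R) :
  diagonalization (spectral_weight p) D c -> (c < +oo)%E ->
  op_summable D p.
Proof.
set phi := spectral_weight p.
move=> [I e lam eo ep De mul cost] cy.
have phi0 t : 0 <= phi t by exact: powR_ge0.
have [A AE] : exists A : H -> H, forall x i, '<A x, e i> = (phi (lam i))%:C * '<x, e i>.
  by have [A AE] := choice mul; exists A.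
exists A; split.
  move=> x y; rewrite (op_fun_diagonal _ eo ep De).
  split=> [h|-> i]; last exact: AE.
  by apply: (coef_inj ep) => i; rewrite AE h.
apply: le_lt_trans cy; apply: le_trans cost; apply: ge_ereal_sup => _ [K [g [[go gd] ->]]].
(* Each diagonal entry <A g_k, g_k> is expanded in the eigenbasis. The double sum is then taken in
   the other order, and for fixed i Bessel for [g] bounds the sum over k by |e_i|^2 = 1. *)
apply: (@le_trans _ _ (\esum_(k in [set: K]) \esum_(i in [set: I])
    (phi (lam i) * sqc '<g k, e i>)%:E)%E).
  apply: le_esum => k _; apply: (Re_dot_le_esum eo ep).
    by move=> i; rewrite mulr_ge0// sqc_ge0.
  by move=> i; rewrite AE -mulrA mulr_conj -rmorphM.
rewrite esum_esum; last by move=> i j _ _; rewrite lee_fin mulr_ge0// sqc_ge0.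
rewrite (@reindex_esum _ _ _ (setT `*`` (fun=> setT)) _ (fun k : I * K => (k.2, k.1))); last first.
  by split=> [k//|[? ?] [? ?] _ _ /= [-> ->]//|[k i] _]; exists (i, k).
rewrite -(@esum_esum _ _ _ setT (fun=> setT) (fun i k => (phi (lam i) * sqc '<g k, e i>)%:E)); last first.
  by move=> i j _ _; rewrite lee_fin mulr_ge0// sqc_ge0.
apply: le_esum => i _; apply: le_trans (esumZ_le _ _) _ => //.
  by move=> k; exact: sqc_ge0.
rewrite -[leRHS]mule1; apply: lee_wpmul2l; first by rewrite lee_fin.
have <- : normsq (e i) = 1 by rewrite /normsq eo eqxx.
apply: le_trans (bessel_esum go (e i)).
by apply: le_esum => k _; rewrite dotC sqc_conj.
Qed.

End DiagonalSummable.

Section DiagonalSum.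
Variables (R : realType) (I : choiceType) (H : I -> prehilbert R).

Lemma normsq_dsum (x : dsum H) : (normsq x)%:E = (\esum_(i in [set: I]) (normsq (fam x i))%:E)%E.
Proof.
rewrite esum_fin; last 2 first.
- by move=> i; exact: normsq_ge0.
- exact: dsum_abs_normsq.
rewrite {1}/normsq /= /dsum_dot /csum /rsum /=.
rewrite [X in _ - fine X]esum1 ?subr0; last first.
  by move=> i _; rewrite max_r// oppr_le0 normsq_ge0.
by congr (fine _)%:E; apply: eq_esum => i _; rewrite max_l// normsq_ge0.
Qed.

(** The vector [u] of [H i] has to be transported along a proof of i = j; by proof irrelevance the
    transport at i itself is the identity. *)
Definition dsum_inj_fam (i : I) (u : H i) (j : I) : H j :=
  if pselect (i = j) is left ij then ecast k (H k) ij u else 0.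

Lemma dsum_inj_famE (i : I) (u : H i) : dsum_inj_fam u i = u.
Proof.
rewrite /dsum_inj_fam; case: pselect => // ii.
by rewrite (Prop_irrelevance ii erefl).
Qed.

Lemma dsum_inj_fam0 (i j : I) (u : H i) : i <> j -> dsum_inj_fam u j = 0.
Proof. by rewrite /dsum_inj_fam; case: pselect. Qed.

Lemma esum_single (i : I) (a : I -> \bar R) : (0 <= a i)%E -> (forall j, i <> j -> a j = 0%E) ->
  (\esum_(j in [set: I]) a j = a i)%E.
Proof.
move=> ai0 a0; rewrite -(@esum_set1 _ _ i)// [RHS]esum_mkcond.
apply: eq_esum => j _; case: ifPn => //; rewrite notin_setE /= => ij.
by apply: a0 => h; apply: ij.
Qed.

Fact dsum_inj_sq (i : I) (u : H i) :
  (\esum_(j in [set: I]) (normsq (dsum_inj_fam u j))%:E < +oo)%E.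
Proof.
rewrite (@esum_single i) ?ltry ?lee_fin ?normsq_ge0// => j ij.
by rewrite dsum_inj_fam0// normsq0.
Qed.

Definition dsum_inj (i : I) (u : H i) : dsum H := DSum (dsum_inj_sq u).

Lemma rsum_single (i : I) (a : I -> R) : (forall j, i <> j -> a j = 0) -> rsum a = a i.
Proof.
move=> a0; rewrite /rsum !(@esum_single i)/=; last 4 first.
- by rewrite lee_fin le_max lexx orbT.
- by move=> j /a0 ->; rewrite oppr0 maxxx.
- by rewrite lee_fin le_max lexx orbT.
- by move=> j /a0 ->; rewrite maxxx.
by case: (leP (a i) 0); case: (leP (- a i) 0) => *; lra.
Qed.

Lemma dot_dsum_inj (x : dsum H) (i : I) (u : H i) : '<x, dsum_inj u> = '<fam x i, u>.
Proof.
rewrite -[LHS]/(csum (fun j => '<fam x j, dsum_inj_fam u j>)) /csum.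
have h j : i <> j -> '<fam x j, dsum_inj_fam u j> = 0.
  by move=> /dsum_inj_fam0 ->; rewrite dotC dot0l rmorph0.
rewrite !(@rsum_single i)/=; try by move=> j /h ->.
by rewrite dsum_inj_famE; case: '<_, _>.
Qed.

(** The basis is the disjoint union of the bases of the summands. As 0 <= phi <= 1, each component
    multiplier is a contraction, so the componentwise images of a square-summable family are again
    square-summable; this provides [diag_phi]. *)
Lemma diagonal_dsum (phi : R -> R) (D : forall i, operator (H i)) (c : I -> \bar R) :
  (forall t, 0 <= phi t <= 1) -> (forall i, diagonalization phi (D i) (c i)) ->
  diagonalization phi (op_dsum D) (\esum_(i in [set: I]) c i)%E.
Proof.
move=> phi01 d.
pose K : choiceType := {i : I & diag_idx (d i)}.
pose e (k : K) := dsum_inj (diag_vec (tagged k)).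
apply: (@Diagonalization _ _ _ _ _ K e (fun k => diag_val (tagged k))).
- move=> [i k] [j l]; rewrite dot_dsum_inj /=.
  have [ij|/eqP ij] := eqVneq i j; last first.
    rewrite dsum_inj_fam0// dot0l.
    by case: eqP => // h; case: ij; exact: (congr1 (@projT1 _ _) h).
  by subst j; rewrite dsum_inj_famE diag_orth -tag_eqE /tag_eq /= eqxx tagged_asE.
- move=> x; rewrite normsq_dsum esum_sigma; last by move=> k; rewrite lee_fin sqc_ge0.
  apply: eq_esum => i _; rewrite (diag_parseval (d i)).
  by apply: eq_esum => j _; rewrite dot_dsum_inj.
- move=> x y; split=> [h [i k]|h i].
    by rewrite !dot_dsum_inj; move: (h i) => /diag_graph.
  by apply/diag_graph => k; have := h (Tagged (fun i => diag_idx (d i)) k); rewrite !dot_dsum_inj.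
- move=> x; pose y i := sval (cid (diag_phi (d i) (fam x i))).
  have yE i (k : diag_idx (d i)) : '<y i, diag_vec k> = (phi (diag_val k))%:C * '<fam x i, diag_vec k>.
    exact: (svalP (cid (diag_phi (d i) (fam x i))) k).
  have ysq : (\esum_(i in [set: I]) (normsq (y i))%:E < +oo)%E.
    apply: dsum_sq_subproof (dsum_abs_normsq x) _ => i.
    apply: (normsq_le_coef (diag_parseval (d i))) => k.
    rewrite yE sqcM sqc_real ler_piMl ?sqc_ge0//.
    by have /andP[? ?] := phi01 (diag_val k); rewrite expr_le1.
  by exists (DSum ysq) => -[i k]; rewrite !dot_dsum_inj yE.
- rewrite esum_sigma; last by move=> k; rewrite lee_fin; have /andP[] := phi01 (diag_val (tagged k)).
  by apply: le_esum => i _; exact: diag_cost.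
Qed.

End DiagonalSum.

(** * Density in L2 *)

Lemma sqc_cvg0 (R : realType) (z : nat -> R[i]) :
  cRe (z n) @[n --> \oo] --> (0 : R) -> cIm (z n) @[n --> \oo] --> (0 : R) ->
  sqc (z n) @[n --> \oo] --> (0 : R).
Proof.
move=> zr zi.
have := cvgD (cvgM zr zr) (cvgM zi zi); rewrite mulr0 addr0.
exact.
Qed.

Section L2Convergence.
Context d (T : measurableType d) (R : realType).
Variable mu : {measure set T -> \bar R}.

Lemma integrable_sqr_Lfun2 (f : T -> R) : measurable_fun setT f ->
  mu.-integrable setT (EFin \o (fun t => f t ^+ 2)) -> f \in Lfun mu 2%:E.
Proof.
move=> mf /integrableP[_ foo]; rewrite inE; apply/andP; split; rewrite inE//=.
rewrite /finite_norm unlock; apply: poweR_lty; apply: le_lt_trans foo.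
rewrite le_eqVlt; apply/orP; left; apply/eqP; apply: eq_integral => t _ /=.
by rewrite powR_mulrn// -normrX.
Qed.

Lemma Lfun2_measurable (f : T -> R) : f \in Lfun mu 2%:E -> measurable_fun setT f.
Proof. by rewrite inE => /andP[+ _]; rewrite inE. Qed.

Lemma le_Lfun2 (f g : T -> R) : measurable_fun setT f -> (forall t, `|f t| <= `|g t|) ->
  g \in Lfun mu 2%:E -> f \in Lfun mu 2%:E.
Proof.
move=> mf fg Lg; apply: integrable_sqr_Lfun2 => //.
apply: le_integrable (Lfun2_integrable_sqr Lg) => //.
  by apply/measurable_EFinP; exact: measurable_funX.
by move=> t _ /=; rewrite lee_fin !normrX lerXn2r ?nnegrE.
Qed.

Lemma L2_pred_measurable (u : T -> R[i]) : u \in L2_pred mu ->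
  measurable_fun setT (fun t => sqc (u t)).
Proof.
move=> /andP[/Lfun2_measurable u1 /Lfun2_measurable u2].
by apply: measurable_funD; apply: measurable_funX.
Qed.

Lemma normsq_L2_class (u : L2fun mu) :
  normsq (L2_class u : L2 mu) = \int[mu]_t sqc (u t).
Proof.
transitivity (cRe (L2_dot (L2_class u) (L2_class u))) => //; rewrite L2_dotE.
by apply: eq_Rintegral => t _; rewrite mulr_conj.
Qed.

Lemma L2_classB (u v : L2fun mu) : L2_class u - L2_class v = L2_class (u - v) :> L2_sort mu.
Proof. by rewrite /L2_class !piE. Qed.

Lemma L2_dominated_cvg (u_ : nat -> L2fun mu) (u : L2fun mu) (g : T -> R) :
  mu.-integrable setT (EFin \o g) ->
  (forall n t, sqc (u_ n t - u t) <= g t) ->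
  (forall t, sqc (u_ n t - u t) @[n --> \oo] --> (0 : R)) ->
  normsq (L2_class (u_ n) - L2_class u : L2 mu) @[n --> \oo] --> (0 : R).
Proof.
move=> ig ug u0.
have m n : measurable_fun setT (fun t => sqc (u_ n t - u t)).
  exact: (L2_pred_measurable (L2_funP (u_ n - u))).
have [|||||_ _] := @dominated_convergence _ _ _ mu setT measurableT
  (fun n t => (sqc (u_ n t - u t))%:E) (fun=> 0%E) (EFin \o g).
- by move=> n; apply/measurable_EFinP.
- exact: measurable_cst.
- by apply: aeW => t _; apply: cvg_EFin (u0 t); exact: nearW.
- exact: ig.
- by apply: aeW => t n _; rewrite lee_fin ger0_norm ?sqc_ge0.
rewrite integral0 => /fine_cvg /=; apply: cvg_trans.
apply: near_eq_cvg; apply: nearW => n /=.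
by rewrite L2_classB normsq_L2_class.
Qed.

End L2Convergence.

Section L2Density.
Context d (T : measurableType d) (R : realType).
Variable mu : {measure set T -> \bar R}.
Hypothesis mu_fin : (mu setT < +oo)%E.
Variables (K : choiceType) (e : K -> L2 mu).

(** Stated for functions rather than classes, so that pointwise sums and limits apply directly. *)
Definition span_fun (u : T -> R[i]) : Prop :=
  exists hu : u \in L2_pred mu, closed_span e (L2_class (L2Fun hu)).

Lemma integrable_cst (c : R) : mu.-integrable setT (EFin \o cst c).
Proof.
apply/integrableP; split; first exact/measurable_EFinP/measurable_cst.
by rewrite (@integral_cst _ _ _ mu _ measurableT `|c|%:E) lte_mul_pinfty.
Qed.

Lemma bounded_Lfun2_finite (f : T -> R) (c : R) : measurable_fun setT f ->
  (forall t, `|f t| <= c) -> f \in Lfun mu 2%:E.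
Proof.
move=> mf fc; apply: integrable_sqr_Lfun2 => //.
apply: le_integrable (integrable_cst (c ^+ 2)) => //.
  by apply/measurable_EFinP; exact: measurable_funX.
move=> t _ /=; rewrite lee_fin !normrX lerXn2r ?nnegrE//.
exact: le_trans (fc t) (ler_norm _).
Qed.

Lemma real_L2_pred (f : T -> R) : f \in Lfun mu 2%:E ->
  (fun t => (f t)%:C) \in L2_pred mu.
Proof.
move=> Lf; rewrite inE; apply/andP; split=> //=.
have [L0 _] := Lfun_submod_closed mu (lee1n 2).
exact: L0.
Qed.

Lemma span_funD u v : span_fun u -> span_fun v -> span_fun (fun t => u t + v t).
Proof.
move=> [hu eu] [hv ev].
have h : (fun t => u t + v t) \in L2_pred mu by exact: (rpredD hu hv).
exists h; have -> : L2Fun h = L2Fun hu + L2Fun hv by exact: val_inj.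
by rewrite L2_classD; exact: closed_spanD.
Qed.

Lemma span_funZ (a : R[i]) u : span_fun u -> span_fun (fun t => a * u t).
Proof.
move=> [hu eu].
have h : (fun t => a * u t) \in L2_pred mu by exact: (rpredZ a hu).
exists h; have -> : L2Fun h = a *: L2Fun hu by exact: val_inj.
by rewrite -L2_classZ; exact: closed_spanZ.
Qed.

Lemma span_fun_sum (J : Type) (s : seq J) (F : J -> T -> R[i]) : span_fun (fun=> 0) ->
  (forall j, span_fun (F j)) -> span_fun (fun t => \sum_(j <- s) F j t).
Proof.
move=> s0 sF; elim: s => [|j s IH].
  by rewrite (_ : (fun _ => _) = fun=> 0)//; apply/funext => t; rewrite big_nil.
rewrite (_ : (fun _ => _) = fun t => F j t + \sum_(i <- s) F i t); first exact: span_funD.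
by apply/funext => t; rewrite big_cons.
Qed.

Lemma span_fun_ae u v : v \in L2_pred mu -> {ae mu, forall t, u t = v t} ->
  span_fun u -> span_fun v.
Proof.
move=> hv uv [hu eu]; exists hv.
by have <- : L2_class (L2Fun hu) = L2_class (L2Fun hv) by apply/L2_classP.
Qed.

Lemma span_fun_dominated (u_ : nat -> T -> R[i]) (u : T -> R[i]) (g : T -> R) :
  (forall n, span_fun (u_ n)) -> u \in L2_pred mu ->
  mu.-integrable setT (EFin \o g) ->
  (forall n t, sqc (u_ n t - u t) <= g t) ->
  (forall t, sqc (u_ n t - u t) @[n --> \oo] --> (0 : R)) -> span_fun u.
Proof.
move=> eu hu ig ug u0; exists hu; apply: closed_span_limit => eps eps0.
pose w n := L2Fun (projT1 (cid (eu n))).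
have := @L2_dominated_cvg _ _ _ _ w (L2Fun hu) g ig ug u0.
move=> /cvgrPdist_lt/(_ eps eps0)[N _ /(_ N (leqnn N))].
rewrite sub0r normrN ger0_norm ?normsq_ge0// => h.
exists (L2_class (w N)); first exact: (projT2 (cid (eu N))).
by rewrite -normsqN opprB.
Qed.

Definition cindic (A : set T) (t : T) : R[i] := (\1_A t)%:C.

Lemma cindicE (A : set T) t : cindic A t = if `[< A t >] then 1 else 0.
Proof.
by rewrite /cindic indicE; case: asboolP => At; [rewrite mem_set|rewrite memNset].
Qed.

Lemma cindic_L2_pred (A : set T) : measurable A -> cindic A \in L2_pred mu.
Proof.
move=> mA; apply: real_L2_pred; apply: (@bounded_Lfun2_finite _ 1).
  exact: measurable_indic.
by move=> t; rewrite indicE; case: (_ \in _); rewrite ?normr1 ?normr0.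
Qed.

Lemma sqc_cindicB_le (A B : set T) t : sqc (cindic A t - cindic B t) <= 1.
Proof.
by rewrite !cindicE; do 2 case: ifP => _;
  rewrite ?subrr ?subr0 ?sub0r ?sqcN ?sqc0// /sqc /= expr1n expr0n addr0.
Qed.

(** Dynkin's pi-lambda argument: complements come from subtracting from the constant 1, and disjoint
    unions from dominated convergence of the finite partial unions, whose indicators are sums. *)
Lemma span_fun_cindic (G : set (set T)) :
  @measurable _ T = <<s G >> -> setI_closed G -> span_fun (cindic setT) ->
  (forall A, G A -> span_fun (cindic A)) ->
  forall A, measurable A -> span_fun (cindic A).
Proof.
move=> mG GI s1 sG A mA.
have s0 : span_fun (fun=> 0).
  have := span_funZ 0 s1; congr span_fun; apply/funext => t; exact: mul0r.
move: (mA); rewrite {1}mG; apply: (@dynkin_induction _ T G (fun A => span_fun (cindic A))) => //.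
- move=> B mB sB; have := span_funD s1 (span_funZ (-1) sB).
  congr span_fun; apply/funext => t; rewrite !cindicE asboolT// mulN1r.
  by rewrite asbool_neg; case: asbool; rewrite ?subrr ?subr0.
- move=> F mF tF sF.
  have sU n : span_fun (cindic (\big[setU/set0]_(k < n) F k)).
    elim: n => [|n IH].
      by move: s0; congr span_fun; apply/funext => t; rewrite big_ord0 /cindic indic0.
    have := span_funD IH (sF n); congr span_fun; apply/funext => t.
    rewrite big_ord_recr /= !cindicE asbool_or.
    case: (asboolP (F n t)) => Fnt; last by rewrite orbF addr0.
    rewrite asboolF ?add0r// -bigcup_mkord => -[k /= kn Fkt].
    by move: kn; rewrite (tF k n I I) ?ltnn//; exists t.
  apply: (span_fun_dominated sU _ (integrable_cst 1)).
  + by apply: cindic_L2_pred; exact: bigcup_measurable.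
  + by move=> n t; exact: sqc_cindicB_le.
  + move=> t; apply: cvg_near_cst.
    have [[k _ Fkt]|nF] := pselect ((\bigcup_k F k) t).
      exists k.+1 => // n kn /=; rewrite !cindicE !asboolT ?subrr ?sqc0//.
        by exists k.
      by rewrite -bigcup_mkord; exists k.
    apply: nearW => n; rewrite !cindicE !asboolF ?subrr ?sqc0//.
    by rewrite -bigcup_mkord => -[k _ Fkt]; apply: nF; exists k.
Qed.

Hypothesis span_indic : forall A, measurable A -> span_fun (cindic A).

Lemma span_fun0 : span_fun (fun=> 0).
Proof.
have := span_indic measurable0; congr span_fun; apply/funext => t.
by rewrite /cindic indic0.
Qed.

Import HBNNSimple.

Lemma span_fun_nnsfun (h : {nnsfun T >-> R}) : span_fun (fun t => (h t)%:C).
Proof.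
have -> : (fun t => (h t)%:C) =
    (fun t => \sum_(y <- finmap.enum_fset (fset_set (range h))) y%:C * cindic (h @^-1` [set y]) t).
  apply/funext => t; rewrite fimfunE fsbig_finite//= rmorph_sum /=.
  by apply: eq_bigr => y _; rewrite rmorphM.
apply: span_fun_sum; first exact: span_fun0.
by move=> y; apply/span_funZ/span_indic; exact: measurable_sfunP.
Qed.

(** Simple functions 0 <= h_n <= f converge to f, and (f - h_n)^2 has the integrable majorant
    f^2. *)
Lemma span_fun_ge0 (f : T -> R) : f \in Lfun mu 2%:E -> (forall t, 0 <= f t) ->
  span_fun (fun t => (f t)%:C).
Proof.
move=> Lf f0; have mf : measurable_fun setT (EFin \o f).
  exact/measurable_EFinP/Lfun2_measurable/Lf.
pose h := nnsfun_approx measurableT mf.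
have f0' t : setT t -> (0 <= (EFin \o f) t)%E by rewrite lee_fin.
have hf n t : h n t <= f t.
  rewrite /h nnsfun_approxE -lee_fin.
  exact: le_approx.
apply: (@span_fun_dominated (fun n t => (h n t)%:C) _ (fun t => f t ^+ 2)).
- by move=> n; exact: span_fun_nnsfun.
- exact: real_L2_pred.
- exact: Lfun2_integrable_sqr.
- move=> n t; rewrite -rmorphB sqc_real -sqrrN opprB.
  by rewrite lerXn2r ?nnegrE ?subr_ge0// gerBl.
- move=> t; have := @cvg_nnsfun_approx _ _ _ _ measurableT _ mf f0' t I.
  move=> /fine_cvg /= hft.
  apply: sqc_cvg0 => /=; last by under eq_fun do rewrite oppr0 addr0; exact: cvg_cst.
  rewrite -(subrr (f t)); apply: cvgB; last exact: cvg_cst.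
  exact: hft.
Qed.

Lemma span_fun_real (f : T -> R) : f \in Lfun mu 2%:E -> span_fun (fun t => (f t)%:C).
Proof.
move=> Lf; have mf := Lfun2_measurable Lf.
have s1 : span_fun (fun t => (Num.max (f t) 0)%:C).
  apply: (@span_fun_ge0 (fun t => Num.max (f t) 0)); last first.
    by move=> t; rewrite le_max lexx orbT.
  apply: le_Lfun2 Lf; first by apply: measurable_maxr.
  by move=> t; case: (leP (f t) 0) => _; rewrite ?normr0.
have s2 : span_fun (fun t => (Num.max (- f t) 0)%:C).
  apply: (@span_fun_ge0 (fun t => Num.max (- f t) 0)); last first.
    by move=> t; rewrite le_max lexx orbT.
  apply: le_Lfun2 Lf; first by apply: measurable_maxr => //; exact: measurable_funN.
  by move=> t; case: (leP (- f t) 0) => _; rewrite ?normr0 ?normrN.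
have := span_funD s1 (span_funZ (-1) s2).
congr span_fun; apply/funext => t; rewrite mulN1r -rmorphB; congr (_%:C).
by case: (leP (f t) 0); case: (leP (- f t) 0) => *; lra.
Qed.

Lemma span_fun_L2 (x : L2 mu) : closed_span e x.
Proof.
have /andP[u1 u2] := L2_funP (L2_repr x).
have [h eh] := span_funD (span_fun_real u1) (span_funZ 'i (span_fun_real u2)).
rewrite -[x]L2_reprK.
suff <- : L2Fun h = L2_repr x by [].
by apply: val_inj; apply/funext => t /=; rewrite -complexE.
Qed.

End L2Density.

(** * Fourier basis of an arc *)

Section StepPolynomial.
Variable R : realType.
Implicit Types a u x y s c : R.

Lemma bernoulli_le a (n : nat) : 0 <= a <= 1 -> 1 - n%:R * a <= (1 - a) ^+ n.
Proof.
move=> /andP[a0 a1]; elim: n => [|n IH]; first by rewrite mul0r subr0.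
rewrite exprS; apply: le_trans (ler_wpM2l _ IH); last by rewrite subr_ge0.
rewrite -natr1 -subr_ge0.
have -> : (1 - a) * (1 - n%:R * a) - (1 - (n%:R + 1) * a) = n%:R * a ^+ 2 by ring.
by rewrite mulr_ge0// sqr_ge0.
Qed.

Lemma bernoulli_inv_le a (n : nat) : 0 <= a <= 1 ->
  (1 - a) ^+ n <= (1 + n%:R * a)^-1.
Proof.
move=> /andP[a0 a1].
have na m : 0 < 1 + m%:R * a by rewrite ltr_pwDl// mulr_ge0.
rewrite -[leRHS]mul1r ler_pdivlMr//.
elim: n => [|n IH]; first by rewrite mul0r addr0 mul1r.
apply: le_trans IH; rewrite exprSr -mulrA; apply: ler_wpM2l.
  by rewrite exprn_ge0// subr_ge0.
rewrite -natr1 -subr_ge0.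
have -> : 1 + n%:R * a - (1 - a) * (1 + (n%:R + 1) * a) = (n%:R + 1) * a ^+ 2 by ring.
by rewrite mulr_ge0// sqr_ge0.
Qed.

(** With y = sqrt x, n y^n <= 1 + y + ... + y^(n-1) <= 1 / (1 - y), hence n x^n <= y^n / (1 - y). *)
Lemma cvg_natr_expr x : 0 <= x < 1 -> n%:R * x ^+ n @[n --> \oo] --> (0 : R).
Proof.
move=> /andP[x0 x1]; pose y := Num.sqrt x.
have y0 : 0 <= y by exact: sqrtr_ge0.
have xE : x = y ^+ 2 by rewrite sqr_sqrtr.
have y1 : y < 1 by rewrite -(@expr_lt1 _ 2)// -xE.
have ny n : n%:R * y ^+ n <= (1 - y)^-1.
  rewrite -[leRHS]mul1r ler_pdivlMr ?subr_gt0//.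
  apply: (@le_trans _ _ (1 - y ^+ n)); last by rewrite gerBl exprn_ge0.
  have -> : 1 - y ^+ n = (1 - y) * \sum_(i < n) y ^+ i.
    by rewrite -[LHS]opprB subrX1 -mulNr opprB.
  rewrite mulrC; apply: ler_wpM2l; first by rewrite subr_ge0 ltW.
  rewrite (_ : n%:R * y ^+ n = \sum_(i < n) y ^+ n); last first.
    by rewrite sumr_const card_ord mulr_natl.
  apply: ler_sum => i _.
  by apply: ler_wiXn2l => //; [exact: ltW|exact: ltnW].
apply: (@squeeze_cvgr _ _ _ _ (fun=> 0) (fun n => (1 - y)^-1 * y ^+ n)).
- apply: nearW => n; apply/andP; split; first by rewrite mulr_ge0// exprn_ge0.
  rewrite xE -exprM mul2n -addnn exprD mulrA.
  by apply: ler_wpM2r => //; rewrite exprn_ge0.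
- exact: cvg_cst.
- by rewrite -(mulr0 (1 - y)^-1); apply: cvgMr; apply: cvg_expr; rewrite ger0_norm.
Qed.

(* With [N = n 2^n] one has [N u^n = n (2u)^n], which tends to 0 for [u < 1/2] and
   to infinity for [u >= 1/2], so the limit is exactly the indicator of [u < 1/2]. *)
Definition step_seq (n : nat) u : R := (1 - u ^+ n) ^+ (n * 2 ^ n).

Lemma step_seq01 n u : 0 <= u <= 1 -> 0 <= step_seq n u <= 1.
Proof.
move=> /andP[u0 u1]; have h : 0 <= u ^+ n <= 1 by rewrite exprn_ge0// exprn_ile1.
by rewrite exprn_ge0 ?exprn_ile1 ?subr_ge0 ?gerBl; case/andP: h => *.
Qed.

(** Below 1/2, Bernoulli gives the lower bound 1 - n (2u)^n. From 1/2 on, its inverse form gives the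
    upper bound 1 / (1 + n (2u)^n) <= 1 / (n + 1). *)
Lemma step_seq_cvg u : 0 <= u <= 1 ->
  step_seq n u @[n --> \oo] --> (if u < 2^-1 then 1 else 0 : R).
Proof.
move=> u01; have /andP[u0 u1] := u01.
have un n : 0 <= u ^+ n <= 1 by rewrite exprn_ge0// exprn_ile1.
have NE n : (n * 2 ^ n)%:R * u ^+ n = n%:R * (2 * u) ^+ n.
  by rewrite natrM natrX exprMn mulrA.
have [u2|u2] := ltP u 2^-1.
  apply: (@squeeze_cvgr _ _ _ _ (fun n => 1 - n%:R * (2 * u) ^+ n) (fun=> 1)).
  - apply: nearW => n; have /andP[_ ->] := step_seq01 n u01.
    by rewrite andbT -NE bernoulli_le.
  - rewrite -[X in _ --> X](subr0 1); apply: cvgB; first exact: cvg_cst.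
    by apply: cvg_natr_expr; lra.
  - exact: cvg_cst.
apply: (@squeeze_cvgr _ _ _ _ (fun=> 0) (@harmonic R)).
- apply: nearW => n; have /andP[-> _] := step_seq01 n u01; rewrite /=.
  apply: le_trans (bernoulli_inv_le _ (un n)) _; rewrite NE.
  rewrite lef_pV2 ?posrE ?ltr_pwDl ?mulr_ge0 ?exprn_ge0 ?mulr_ge0//.
  rewrite -nat1r lerD2l ler_peMr//; apply: exprn_ege1; lra.
- exact: cvg_cst.
- exact: cvg_harmonic.
Qed.

End StepPolynomial.

(** * Completeness of the exponentials *)

Section ArcDensity.
Variables (R : realType) (r : {posnum R}).
Local Notation mu := (arc_measure r).
Local Notation e := (@basis_vec R r).
Local Notation span := (span_fun (mu := mu) e).

Lemma expoD (l m : int) t : expo r l t * expo r m t = expo r (l + m) t.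
Proof.
rewrite /expo intrD mulrDl mulrDl cosD sinD; apply/eqP; rewrite eq_complex /=.
by apply/andP; split; apply/eqP; ring.
Qed.

Lemma expo0 t : expo r 0 t = 1.
Proof. by rewrite /expo !mul0r cos0 sin0. Qed.

Lemma conj_expo l t : (expo r l t)^* = expo r (- l) t.
Proof. by rewrite conj_complexE /expo /= !mulrNz !mulNr cosN sinN. Qed.

Lemma sqc_expo l t : sqc (expo r l t) = 1.
Proof. by rewrite /sqc /= cos2Dsin2. Qed.

Inductive trig_poly : (R -> R[i]) -> Prop :=
| trig_expo l : trig_poly (expo r l)
| trig_add u v : trig_poly u -> trig_poly v -> trig_poly (fun t => u t + v t)
| trig_scale a u : trig_poly u -> trig_poly (fun t => a * u t).

Lemma trig_mul u v : trig_poly u -> trig_poly v -> trig_poly (fun t => u t * v t).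
Proof.
move=> pu pv; elim: pu => [l|u1 u2 _ IH1 _ IH2|a u1 _ IH].
- elim: pv => [m|v1 v2 _ IH1 _ IH2|a v1 _ IH].
  + by under eq_fun do rewrite expoD; exact: trig_expo.
  + by under eq_fun do rewrite mulrDr; exact: trig_add.
  + by under eq_fun do rewrite mulrCA; exact: trig_scale.
- by under eq_fun do rewrite mulrDl; exact: trig_add.
- by under eq_fun do rewrite -mulrA; exact: trig_scale.
Qed.

Lemma trig_cst (a : R[i]) : trig_poly (fun=> a).
Proof.
have := trig_scale a (trig_expo 0); congr trig_poly.
by apply/funext => t; rewrite expo0 mulr1.
Qed.

Lemma trig_exp u n : trig_poly u -> trig_poly (fun t => u t ^+ n).
Proof.
move=> pu; elim: n => [|n IH]; first exact: (trig_cst 1).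
by under eq_fun do rewrite exprS; exact: trig_mul.
Qed.

(** Euler's formula, with the shift by [a] absorbed into the coefficients of e^(it/r) and
    e^(-it/r). *)
Lemma trig_cos a : trig_poly (fun t => (cos ((t - a) / r%:num))%:C).
Proof.
have := trig_add (trig_scale (2^-1 * expo r (-1) a) (trig_expo 1))
                 (trig_scale (2^-1 * expo r 1 a) (trig_expo (-1))).
congr trig_poly; apply/funext => t; rewrite /expo.
rewrite !mulNr !mul1r !cosN !sinN mulrBl cosB.
rewrite -[2^-1 : R[i]](_ : (2^-1)%:C = _); last by rewrite fmorphV rmorph_nat.
apply/eqP; rewrite eq_complex /=; apply/andP; split; apply/eqP; by field.
Qed.

Lemma span_trig u : trig_poly u -> span u.
Proof.
elim=> [l|u1 u2 _ IH1 _ IH2|a u1 _ IH].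
- by exists (expo_L2 r l); exact: closed_span_basis.
- exact: span_funD.
- exact: span_funZ.
Qed.

Lemma arc_measure_fin : (mu setT < +oo)%E.
Proof. by rewrite arc_measure_setT ltry. Qed.

Lemma span_arc (a c : R) : -1 <= c <= 1 ->
  span (cindic R [set t : measurableTypeR R | cos ((t - a) / r%:num) < c]).
Proof.
move=> /andP[c1 c2].
(* Since |cos - c| <= 2, division by 4 keeps [w] in [0, 1], and the threshold 1/2 sits exactly at
   cos = c. There [step_seq] tends to 0, which matches the strict inequality. *)
pose w t : R := 2^-1 + (cos ((t - a) / r%:num) - c) / 4.
have w01 t : 0 <= w t <= 1.
  have := cos_geN1 ((t - a) / r%:num); have := cos_le1 ((t - a) / r%:num).
  by rewrite /w => *; apply/andP; split; lra.
have wlt t : (w t < 2^-1) = (cos ((t - a) / r%:num) < c).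
  by rewrite /w; apply/idP/idP => ?; lra.
have wp : trig_poly (fun t => (w t)%:C).
  have := trig_add (trig_scale (4^-1)%:C (trig_cos a)) (trig_cst (2^-1 - c / 4)%:C).
  congr trig_poly; apply/funext => t; rewrite -rmorphM -rmorphD; congr (_%:C).
  by rewrite /w; field.
have mw : measurable_fun setT (fun t : measurableTypeR R => cos ((t - a) / r%:num)).
  apply: (measurableT_comp (f := @cos R)).
    by apply: continuous_measurable_fun; exact: continuous_cos.
  by apply: measurable_funM => //; exact: measurable_funB.
apply: (@span_fun_dominated _ _ _ mu _ e (fun n t => (step_seq n (w t))%:C) _ (cst 1)).
- move=> n; apply: span_trig.
  have := trig_exp (n * 2 ^ n) (trig_add (trig_cst 1) (trig_scale (-1) (trig_exp n wp))).
  congr trig_poly; apply/funext => t.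
  by rewrite mulN1r -rmorphXn -[X in X - _](rmorph1 (real_complex R)) -rmorphB -rmorphXn.
- apply: (cindic_L2_pred arc_measure_fin).
  rewrite -[X in measurable X]setTI.
  have := mw measurableT _ (measurable_itv `]-oo, c[).
  by congr measurable; congr (_ `&` _); apply/seteqP; split=> t /=; rewrite in_itv.
- exact: (integrable_cst arc_measure_fin).
- move=> n t; rewrite cindicE /= -wlt.
  have /andP[s0 s1] := step_seq01 n (w01 t).
  have -> : (if `[< w t < 2^-1 >] then 1 else 0 : R[i]) =
      (if `[< w t < 2^-1 >] then 1 else 0 : R)%:C by case: asbool.
  by rewrite -rmorphB sqc_real; case: asbool; nra.
- move=> t; apply: sqc_cvg0; rewrite cindicE asboolb -wlt.
    rewrite (_ : (fun n => _) = fun n => step_seq n (w t) - (if w t < 2^-1 then 1 else 0)).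
      have := cvgB (step_seq_cvg (w01 t)) (cvg_cst (if w t < 2^-1 then 1 else 0 : R)).
      by rewrite subrr; exact.
    by apply/funext => n /=; case: ifP.
  rewrite (_ : (fun n => _) = fun=> 0); first exact: cvg_cst.
  by apply/funext => n /=; case: ifP => _ /=; rewrite oppr0 addr0.
Qed.

(** The right end is left out because it is the same point of the circle as the left one, and the
    equivalence of [cos_ray] fails there. *)
Lemma ae_arc : {ae mu, forall t, - (pi * r%:num) <= t < pi * r%:num}.
Proof.
exists (~` `[- (pi * r%:num), pi * r%:num[); split.
- by apply: measurableC; exact: measurable_itv.
- rewrite /arc_measure /= /mscale /= /mrestr.
  rewrite (_ : ~` _ `&` _ = [set pi * r%:num]) ?lebesgue_measure_set1 ?mule0//.
  have pr : 0 < pi * r%:num by rewrite mulr_gt0// pi_gt0.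
  apply/seteqP; split=> t /=; rewrite !in_itv /=.
    move=> [/negP + /andP[h1 h2]]; rewrite h1 /= -leNgt => h3.
    by apply/le_anti; rewrite h2 h3.
  move=> ->; rewrite lexx ltxx andbF; split => //; rewrite andbT.
  by rewrite (@le_trans _ _ 0)// ?oppr_le0 ltW.
- by move=> t; rewrite /= in_itv.
Qed.

(* On [[- pi r, pi r[], the ray beyond [x] is the complement of an arc centred
   at the midpoint of [- pi r] and [x]. *)
Lemma cos_ray (x t : R) (P := pi * r%:num) : - P <= x < P -> - P <= t < P ->
  (cos ((t - (x - P) / 2) / r%:num) < cos (((x + P) / 2) / r%:num)) = (x < t).
Proof.
move=> /andP[x1 x2] /andP[t1 t2].
set v := (t - _) / _; set h := _ / r%:num.
have r0 : 0 < r%:num :> R by [].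
have PE : P / r%:num = pi by rewrite mulfK.
have h0 : 0 <= h by rewrite divr_ge0//; lra.
have hpi : h < pi by rewrite -PE ltr_pM2r ?invr_gt0//; lra.
have hI : h \in `[0, pi] by rewrite in_itv /= h0 ltW.
have [xt|tx] := ltP x t.
  have hv : h < v by rewrite ltr_pM2r ?invr_gt0//; lra.
  have [vpi|vpi] := leP v pi.
    by rewrite ltr_cos// in_itv /= vpi andbT; lra.
  (* Past pi, -v + 2 pi has the same cosine as v and lies strictly between h and pi. *)
  have v2 : v < 2 * pi - h.
    have -> : 2 * pi - h = (2 * P - (x + P) / 2) / r%:num by rewrite mulrBl -mulrA PE.
    by rewrite ltr_pM2r ?invr_gt0//; lra.
  rewrite -cosN -cosD2pi ltr_cos//; first by rewrite mulr2n; lra.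
  by rewrite in_itv /= mulr2n; apply/andP; split; lra.
apply/negbTE; rewrite -leNgt.
have vh : `|v| <= h.
  by rewrite ler_norml /v /h -mulNr !ler_pM2r ?invr_gt0//; apply/andP; split; lra.
rewrite -(cos_norm v) leNgt ltr_cos// -?leNgt// in_itv /= normr_ge0 /=.
by rewrite (le_trans vh)// ltW.
Qed.

Lemma arc_closed_span (x : L2 mu) : closed_span e x.
Proof.
have fin := arc_measure_fin.
have ae_filter : Filter (almost_everywhere mu) := ae_filter_ringOfSetsType mu.
have s1 : span (cindic R setT).
  have := span_trig (trig_cst 1); congr span_fun; apply/funext => t.
  by rewrite cindicE asboolT.
apply: span_fun_L2.
refine (@span_fun_cindic _ _ _ _ fin _ e (@RGenOInfty.G R) _ _ s1 _).
- exact: RGenOInfty.measurableE.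
- move=> _ _ [a ->] [b ->]; exists (Num.max a b).
  by apply/seteqP; split=> t /=; rewrite !in_itv /= !andbT gt_max => /andP.
(* Up to a null set the ray is empty for x0 >= P, everything for x0 < - P, and otherwise the arc of
   [cos_ray]. *)
- move=> _ [x0 ->]; set P := pi * r%:num.
  have hA : cindic R `]x0, +oo[%classic \in L2_pred mu.
    by apply: (cindic_L2_pred fin); exact: measurable_itv.
  have [xP|xP] := leP P x0.
    apply: span_fun_ae hA _ (span_trig (trig_cst 0)).
    apply: filterS ae_arc => t /andP[_ tP]; rewrite cindicE asboolF//= in_itv /= andbT.
    by apply/negP; rewrite -leNgt (le_trans (ltW tP)).
  have [xN|xN] := ltP x0 (- P).
    apply: span_fun_ae hA _ s1; apply: filterS ae_arc => t /andP[tP _].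
    by rewrite !cindicE !asboolT//= in_itv /= andbT (lt_le_trans xN).
  have := @span_arc ((x0 - P) / 2) (cos (((x0 + P) / 2) / r%:num)).
  rewrite cos_geN1 cos_le1 => /(_ isT) /span_fun_ae; apply => //.
  apply: filterS ae_arc => t tP; rewrite !cindicE; congr (if _ then _ else _).
  by apply/asbool_equiv_eq; rewrite /= cos_ray ?xN// in_itv /= andbT.
Qed.

End ArcDensity.

(** * Orthonormality of the exponentials *)

Section ArcOrthonormal.
Variables (R : realType) (r : {posnum R}).
Local Notation mu := (arc_measure r).
Local Notation P := (pi * r%:num).

Lemma arc_integral_ge0 (f F : R -> R) : continuous f -> (forall t, 0 <= f t) ->
  (forall t : R, is_derive t 1 F (f t)) ->
  (\int[mu]_t (f t)%:E = ((2 * pi * r%:num)^-1 * (F P - F (- P)))%:E)%E.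
Proof.
move=> cf f0 dF.
have pr : 0 < P by rewrite mulr_gt0// pi_gt0.
have mf : measurable_fun setT (EFin \o f).
  by apply/measurable_EFinP; exact: continuous_measurable_fun.
pose D : set (measurableTypeR R) := `[- P, P]%classic.
have mD : measurable D by exact: measurable_itv.
have D0 : mu (~` D) = 0%E.
  by rewrite /arc_measure /= /mscale /= /mrestr setICl measure0 mule0.
rewrite (@ge0_negligible_integral _ _ _ mu _ (~` D))//; last 2 first.
- exact: measurableC.
- by move=> t _; rewrite lee_fin.
rewrite setTD setCK.
pose k := NngNum (arc_density_ge0 r).
rewrite (@eq_measure_integral _ _ _ _ (mscale k lebesgue_measure)); last first.
  by move=> A mA AD; rewrite /arc_measure /= /mscale /= /mrestr setIidl.
rewrite ge0_integral_mscale//; last 2 first.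
- exact: measurable_funTS.
- by move=> t _; rewrite lee_fin.
rewrite EFinM EFinB; congr (_ * _)%E.
have cF x : {for x, continuous F}.
  apply: differentiable_continuous; apply/derivable1_diffP.
  by have := dF x; case.
apply: continuous_FTC2.
- by rewrite (@lt_trans _ _ 0)// oppr_lt0.
- by apply: continuous_subspaceT.
- split.
  + by move=> x _; have := dF x; case.
  + by apply: cvg_at_right_filter; exact: cF.
  + by apply: cvg_at_left_filter; exact: cF.
- by move=> x _; rewrite derive1E; have := dF x; case.
Qed.

(** As |g| <= 1, the formula for nonnegative integrands applies to 1 + g with primitive t + G t.
    Since G agrees at both ends, only the total mass 1 remains, so g contributes 0. *)
Lemma arc_mean0 (g G : R -> R) : continuous g -> (forall t, `|g t| <= 1) ->
  (forall t : R, is_derive t 1 G (g t)) -> G P = G (- P) ->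
  \int[mu]_t g t = 0.
Proof.
move=> cg g1 dG GP.
have ig : mu.-integrable setT (EFin \o g).
  apply: le_integrable (integrable_cst (arc_measure_fin r) 1) => //.
    by apply/measurable_EFinP; exact: continuous_measurable_fun.
  by move=> t _ /=; rewrite lee_fin normr1.
have i1 : mu.-integrable setT (EFin \o cst 1) := integrable_cst (arc_measure_fin r) 1.
have h1 : continuous (fun t : R => 1 + g t).
  by move=> x; apply: cvgD; [exact: cvg_cst|exact: cg].
have h2 (t : R) : 0 <= 1 + g t by have := g1 t; rewrite ler_norml => /andP[? _]; lra.
have h3 (t : R) : is_derive t 1 (fun t => t + G t) (1 + g t) by exact: is_deriveD.
have := congr1 fine (arc_integral_ge0 h1 h2 h3).
rewrite -[fine (integral _ _ _)]/(\int[mu]_t (1 + g t)) RintegralD//.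
rewrite [X in X + _]Rintegral_cst// arc_measure_setT /= mulr1.
rewrite GP opprD addrACA subrr addr0 opprK.
have -> : (2 * pi * r%:num)^-1 * (P + P) = 1.
  by rewrite -mulr2n -(mulr_natl P) [2 * P]mulrA mulVf// !mulf_neq0// gt_eqF// pi_gt0.
by move=> h; apply: (addrI 1); rewrite addr0.
Qed.

Lemma sin_int_pi (l : int) : sin (l%:~R * pi) = 0 :> R.
Proof.
have h (n : nat) : sin (n%:R * pi) = 0 :> R.
  have := alternatingn (@sinDpi R) n 0.
  by rewrite add0r sin0 mulr0 mulr_natl.
by case: l => n; [exact: h|rewrite NegzE mulrNz mulNr sinN h oppr0].
Qed.

(** The real and imaginary parts have primitives (r/l) sin (lt/r) and -(r/l) cos (lt/r), which agree
    at both ends because sin (l pi) = 0 and cos is even. *)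
Lemma arc_expo_mean0 (l : int) : l != 0 -> cintegral mu (expo r l) = 0.
Proof.
move=> l0; have lR : l%:~R != 0 :> R by rewrite intr_eq0.
have rR : r%:num != 0 :> R by [].
have dl (t : R) : is_derive t 1 (fun t => l%:~R * t / r%:num) (l%:~R / r%:num).
  rewrite (_ : (fun t => _) = (l%:~R / r%:num) \*: (id : R -> R)).
    by apply: is_derive_eq; rewrite /GRing.scale /= mulr1.
  by apply/funext => s /=; rewrite /GRing.scale /= mulrAC.
have cl : continuous (fun t : R => l%:~R * t / r%:num).
  by move=> t; apply: differentiable_continuous; apply/derivable1_diffP; have [] := dl t.
have PE (s : R) : l%:~R * (s * P) / r%:num = s * (l%:~R * pi).
  by field.
rewrite /cintegral /expo /=; apply/eqP; rewrite eq_complex /=; apply/andP; split; apply/eqP.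
  apply: (@arc_mean0 _ (fun t => r%:num / l%:~R * sin (l%:~R * t / r%:num))).
  - by move=> t; apply: continuous_comp; [exact: cl|exact: continuous_cos].
  - by move=> t; rewrite ler_norml cos_geN1 cos_le1.
  - move=> t.
    have := is_deriveZ (r%:num / l%:~R) (@is_derive1_comp _ sin _ _ _ _ (is_derive_sin _) (dl t)).
    move=> h; apply: is_derive_eq.
    by rewrite /GRing.scale /=; field; rewrite lR rR.
  - have := PE 1; have := PE (-1); rewrite !mulN1r !mul1r => -> ->.
    by rewrite sinN sin_int_pi oppr0.
apply: (@arc_mean0 _ (fun t => - (r%:num / l%:~R) * cos (l%:~R * t / r%:num))).
- by move=> t; apply: continuous_comp; [exact: cl|exact: continuous_sin].
- by move=> t; rewrite ler_norml sin_geN1 sin_le1.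
- move=> t.
  have := is_deriveZ (- (r%:num / l%:~R)) (@is_derive1_comp _ cos _ _ _ _ (is_derive_cos _) (dl t)).
  move=> h; apply: is_derive_eq.
  by rewrite /GRing.scale /=; field; rewrite lR rR.
- have := PE 1; have := PE (-1); rewrite !mulN1r !mul1r => -> ->.
  by rewrite cosN.
Qed.

Lemma basis_vec_orth (l m : int) : '<basis_vec r l, basis_vec r m> = (l == m)%:R.
Proof.
transitivity (cintegral mu (expo r (l - m))).
  transitivity (L2_dot (basis_vec r l) (basis_vec r m)) => //.
  rewrite /basis_vec L2_dotE; congr cintegral; apply/funext => t /=.
  by rewrite conj_expo expoD.
have [->|lm] := eqVneq l m; last by apply: arc_expo_mean0; rewrite subr_eq0.
rewrite subrr /cintegral.
under eq_Rintegral do rewrite expo0 /=.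
under [X in _ +i* X]eq_Rintegral do rewrite expo0 /=.
rewrite !Rintegral_cst// mul0r mul1r.
by rewrite arc_measure_setT.
Qed.

End ArcOrthonormal.

(** * Multipliers on an arc *)

Section DominatedSeries.
Context d (T : measurableType d) (R : realType).

(** The Weierstrass M-test. One constant bounds both the partial sums and the limit, as is needed
    later for dominated convergence. *)
Lemma dominated_series (v : nat -> T -> R) (b : nat -> R) (C : R) :
  (forall n, measurable_fun setT (v n)) -> (forall n t, `|v n t| <= b n) ->
  (forall N, \sum_(n < N) b n <= C) ->
  exists g : T -> R, [/\ measurable_fun setT g, (forall t, `|g t| <= C),
    (forall t N, `|\sum_(n < N) v n t| <= C) &
    forall t, \sum_(n < N) v n t @[N --> \oo] --> g t].
Proof.
move=> mv vb bC.
have sE t N : series (v^~ t) N = \sum_(n < N) v n t by rewrite /series /= big_mkord.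
have cv t : cvgn (series (v^~ t)).
  apply: normed_cvg; apply: nondecreasing_is_cvgn.
    by apply: nondecreasing_series => n _ _; exact: normr_ge0.
  exists C => _ [N _ <-] /=; rewrite /series /= big_mkord.
  by apply: le_trans (bC N); apply: ler_sum.
have vC t N : `|\sum_(n < N) v n t| <= C.
  by apply: le_trans (ler_norm_sum _ _ _) _; apply: le_trans (bC N); apply: ler_sum.
have cg t : \sum_(n < N) v n t @[N --> \oo] --> limn (series (v^~ t)).
  have -> : (fun N => \sum_(n < N) v n t) = series (v^~ t).
    by apply/funext => N; rewrite sE.
  exact: cv.
exists (fun t => limn (series (v^~ t))); split => //.
- apply: (@measurable_fun_cvg _ _ _ _ (fun N t => \sum_(n < N) v n t)) => //.
  by move=> N; apply: measurable_sum.
- move=> t; apply: (cvgr_to_le (cvg_norm (cg t))).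
  by apply: nearW => N; exact: vC.
Qed.

End DominatedSeries.

Section ArcMultiplier.
Variables (R : realType) (r : {posnum R}).
Local Notation mu := (arc_measure r).
Local Notation e := (@basis_vec R r).

(** Each n is taken exactly at l = n and l = -1 - n, the two integers with |l + 1/2| = n + 1/2. *)
Definition int_index (l : int) : nat := match l with Posz n => n | Negz n => n end.

Definition arc_partial (c : int -> R[i]) (N : nat) : L2fun mu :=
  \sum_(n < N) (c (Posz n) *: L2Fun (expo_L2 r (Posz n)) +
                c (Negz n) *: L2Fun (expo_L2 r (Negz n))).

Lemma arc_partialE c N t : arc_partial c N t =
  \sum_(n < N) (c (Posz n) * expo r (Posz n) t + c (Negz n) * expo r (Negz n) t).
Proof.
rewrite /arc_partial; elim: N => [|N IH]; first by rewrite !big_ord0.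
by rewrite big_ord_recr [RHS]big_ord_recr /= -IH.
Qed.

Lemma arc_partial_coef c N l :
  '<(L2_class (arc_partial c N) : L2 mu), e l> = if (int_index l < N)%N then c l else 0.
Proof.
elim: N => [|N IH]; first by rewrite /arc_partial big_ord0 L2_class0 dot0l.
rewrite /arc_partial big_ord_recr L2_classD -/(arc_partial c N) dotDl IH.
rewrite L2_classD -!L2_classZ.
rewrite [X in _ + X](_ : _ = c (Posz N) * '<e (Posz N), e l> + c (Negz N) * '<e (Negz N), e l>); last first.
  by rewrite -!dotZl -dotDl.
rewrite !basis_vec_orth ltnS [X in _ = if X then _ else _]leq_eqVlt.
case: l {IH} => n /=.
  rewrite mulr0 addr0 eqz_nat eq_sym.
  have [->|_] := eqVneq n N; first by rewrite ltnn add0r mulr1.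
  by rewrite mulr0 addr0.
rewrite mulr0 add0r.
rewrite [Negz N == Negz n](_ : _ = (n == N)); last by rewrite eq_sym.
have [->|_] := eqVneq n N; first by rewrite ltnn add0r mulr1.
by rewrite mulr0 addr0.
Qed.

Lemma norm_Re_le (z : R[i]) : `|cRe z| <= sqc z + 1.
Proof. by rewrite /sqc; case: z => a b /=; rewrite ler_norml; apply/andP; split; nra. Qed.

Lemma norm_Im_le (z : R[i]) : `|cIm z| <= sqc z + 1.
Proof. by rewrite /sqc; case: z => a b /=; rewrite ler_norml; apply/andP; split; nra. Qed.

(* The multiplier series converges uniformly, since the coefficients of [x] are
   bounded; no completeness of L2 is needed. *)
Lemma arc_multiplier (a : int -> R) (x : L2 mu) : (forall l, 0 <= a l) ->
  (\esum_(l in [set: int]) (a l)%:E < +oo)%E ->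
  exists y : L2 mu, forall l, '<y, e l> = (a l)%:C * '<x, e l>.
Proof.
move=> a0 aoo.
pose c l : R[i] := (a l)%:C * '<x, e l>.
pose M := normsq x + 1.
have M0 : 0 <= M by rewrite addr_ge0 ?normsq_ge0.
pose A := fine (\esum_(l in [set: int]) (a l)%:E).
have aA (s : seq int) : uniq s -> \sum_(l <- s) a l <= A.
  move=> us; rewrite -lee_fin fineK; first exact: finite_le_esum.
  by rewrite ge0_fin_numE// esum_ge0// => l _; rewrite lee_fin.
(* The factor 2M comes from |Re z|, |Im z| <= |z|^2 + 1 at z = <x, e_l> e^(ilt/r), where |z|^2 <=
   |x|^2 by Bessel. *)
pose b n := (a (Posz n) + a (Negz n)) * M * 2.
have bC N : \sum_(n < N) b n <= A * M * 2.
  rewrite /b -!mulr_suml; do 2 apply: ler_wpM2r => //.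
  rewrite big_split /= -(big_mkord xpredT (fun n => a (Posz n))) -(big_mkord xpredT (fun n => a (Negz n))).
  rewrite -(big_map Posz xpredT a) -(big_map Negz xpredT a) -big_cat; apply: aA.
  rewrite cat_uniq !map_inj_uniq ?iota_uniq; try by move=> ? ? [].
  by rewrite andbT; apply/hasPn => _ /mapP[m _ ->]; apply/negP => /mapP[].
pose v n t := c (Posz n) * expo r (Posz n) t + c (Negz n) * expo r (Negz n) t.
have cb l t : `|cRe (c l * expo r l t)| <= a l * M * 2 /\ `|cIm (c l * expo r l t)| <= a l * M * 2.
  rewrite /c -mulrA; have zM : sqc ('<x, e l> * expo r l t) + 1 <= M * 2.
    rewrite sqcM sqc_expo mulr1 /M.
    by have := bessel1 (@basis_vec_orth _ r) l x; have := normsq_ge0 x; lra.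
  have h1 := le_trans (norm_Re_le _) zM; have h2 := le_trans (norm_Im_le _) zM.
  rewrite -mulrA; move: h1 h2; case: (_ * expo r l t) => z1 z2 /= h1 h2.
  rewrite !mul0r subr0 addr0 !normrM ger0_norm//.
  by split; apply: ler_wpM2l.
have vL2 n : v n \in L2_pred mu.
  have := L2_funP (c (Posz n) *: L2Fun (expo_L2 r (Posz n)) + c (Negz n) *: L2Fun (expo_L2 r (Negz n))).
  by [].
have ReD (z w : R[i]) : cRe (z + w) = cRe z + cRe w by exact: raddfD.
have ImD (z w : R[i]) : cIm (z + w) = cIm z + cIm w by exact: raddfD.
have [g1 [mg1 g1C v1C g1v]] : exists g : measurableTypeR R -> R, [/\ measurable_fun setT g,
    (forall t, `|g t| <= A * M * 2), (forall t N, `|\sum_(n < N) cRe (v n t)| <= A * M * 2) &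
    forall t, \sum_(n < N) cRe (v n t) @[N --> \oo] --> g t].
  apply: (@dominated_series _ (measurableTypeR R) R (fun n t => cRe (v n t)) b) => // [n|n t].
    by have /andP[/Lfun2_measurable] := vL2 n.
  rewrite ReD (le_trans (ler_normD _ _))// /b !mulrDl; apply: lerD.
    exact: (cb (Posz n) t).1.
  exact: (cb (Negz n) t).1.
have [g2 [mg2 g2C v2C g2v]] : exists g : measurableTypeR R -> R, [/\ measurable_fun setT g,
    (forall t, `|g t| <= A * M * 2), (forall t N, `|\sum_(n < N) cIm (v n t)| <= A * M * 2) &
    forall t, \sum_(n < N) cIm (v n t) @[N --> \oo] --> g t].
  apply: (@dominated_series _ (measurableTypeR R) R (fun n t => cIm (v n t)) b) => // [n|n t].
    by have /andP[_ /Lfun2_measurable] := vL2 n.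
  rewrite ImD (le_trans (ler_normD _ _))// /b !mulrDl; apply: lerD.
    exact: (cb (Posz n) t).2.
  exact: (cb (Negz n) t).2.
have gL2 : (fun t => g1 t +i* g2 t) \in L2_pred mu.
  rewrite inE; apply/andP; split => /=.
    exact: (bounded_Lfun2_finite (arc_measure_fin r) mg1 g1C).
  exact: (bounded_Lfun2_finite (arc_measure_fin r) mg2 g2C).
pose Y := L2Fun gL2.
have sR N t : cRe (arc_partial c N t) = \sum_(n < N) cRe (v n t).
  by rewrite arc_partialE raddf_sum.
have sI N t : cIm (arc_partial c N t) = \sum_(n < N) cIm (v n t).
  by rewrite arc_partialE raddf_sum.
have sq2 (s g K : R) : `|s| <= K -> `|g| <= K -> (s - g) ^+ 2 <= (K * 2) ^+ 2.
  rewrite !ler_norml => /andP[? ?] /andP[? ?].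
  by rewrite -subr_ge0 subr_sqr mulr_ge0//; lra.
have SY : normsq (L2_class (arc_partial c N) - L2_class Y : L2 mu) @[N --> \oo] --> (0 : R).
  (* With K = A * M * 2 bounding partial sums and limit, each squared difference is at most (2K)^2;
     the real and imaginary parts account for the last factor 2. *)
  apply: (@L2_dominated_cvg _ _ _ mu _ _ (cst ((A * M * 2 * 2) ^+ 2 * 2))).
  - exact: (integrable_cst (arc_measure_fin r)).
  - move=> N t; rewrite /sqc !raddfB /= sR sI mulr_natr mulr2n; apply: lerD.
      exact: sq2 (v1C t N) (g1C t).
    exact: sq2 (v2C t N) (g2C t).
  - move=> t; apply: sqc_cvg0.
      rewrite (_ : (fun N => _) = fun N => \sum_(n < N) cRe (v n t) - g1 t).
        by have := cvgB (g1v t) (cvg_cst (g1 t)); rewrite subrr; exact.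
      by apply/funext => N; rewrite -sR raddfB.
    rewrite (_ : (fun N => _) = fun N => \sum_(n < N) cIm (v n t) - g2 t).
      by have := cvgB (g2v t) (cvg_cst (g2 t)); rewrite subrr; exact.
    by apply/funext => N; rewrite -sI raddfB.
exists (L2_class Y) => l; apply/eqP; rewrite -subr_eq0 -sqc_eq0; apply/eqP/le_anti.
rewrite sqc_ge0 andbT; apply/ler_addgt0Pr => eps eps0; rewrite add0r.
move/cvgrPdist_lt: SY => /(_ eps eps0)[N _ hN].
(* From this index on, the partial sum has coefficient exactly [c l], and Bessel bounds its squared
   distance to <Y, e_l> by eps. *)
pose K := maxn N (int_index l).+1.
have := hN K (leq_maxl _ _); rewrite sub0r normrN ger0_norm ?normsq_ge0// => /ltW; apply: le_trans.
apply: le_trans (bessel1 (@basis_vec_orth _ r) l _).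
rewrite dotBl arc_partial_coef leq_maxr -/(c l).
by rewrite -sqcN opprB.
Qed.

Lemma arc_diagonal (phi : R -> R) (C : \bar R) : (forall t, 0 <= phi t) ->
  (\esum_(l in [set: int]) (phi ((l%:~R + 2^-1) / r%:num))%:E <= C)%E -> (C < +oo)%E ->
  diagonalization phi (@arc_dirac R r) C.
Proof.
move=> phi0 sC Coo.
apply: (@Diagonalization _ _ _ _ _ int e (fun l => (l%:~R + 2^-1) / r%:num)) => //.
- exact: basis_vec_orth.
- by apply: closed_span_parseval; [exact: basis_vec_orth|exact: arc_closed_span].
- move=> x; apply: arc_multiplier => [l//|].
  exact: le_lt_trans sC Coo.
Qed.

End ArcMultiplier.

(** * Convergence of the eigenvalue sums *)

Section EsumBounds.
Variable R : realType.

Lemma esum_le_seq (I : choiceType) (A : set I) (a : I -> \bar R) (s : seq I) :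
  uniq s -> (forall i, A i -> i \in s) -> (forall i, 0 <= a i)%E ->
  (\esum_(i in A) a i <= \sum_(i <- s) a i)%E.
Proof.
move=> us As a0; apply: ge_ereal_sup => _ [X [finX XA] <-].
rewrite fsbig_finite//=; set t := finmap.enum_fset _.
have ts : {subset t <= s} by move=> i; rewrite in_fset_set// inE => /XA/As.
rewrite [leRHS](bigID (mem t)) /= -[X in (_ <= X + _)%E]big_filter.
rewrite [X in (_ <= X + _)%E](perm_big t) /=; first by rewrite leeDl// sume_ge0.
apply: uniq_perm; rewrite ?filter_uniq ?finmap.fset_uniq// => i.
by rewrite mem_filter; case: (boolP (i \in t)) => // /ts ->.
Qed.

Lemma esum_cst_le (I : choiceType) (A : set I) (c : R) (s : seq I) :
  uniq s -> (forall i, A i -> i \in s) -> 0 <= c ->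
  (\esum_(i in A) c%:E <= ((size s)%:R * c)%:E)%E.
Proof.
move=> us As c0; apply: le_trans (esum_le_seq us As _) _ => //.
by rewrite sumEFin big_const_seq count_predT iter_addr_0 mulr_natl.
Qed.

Lemma esum_nat_le (u : nat -> R) (C : R) : (forall n, 0 <= u n) ->
  (forall N, \sum_(n < N) u n <= C) -> (\esum_(n in [set: nat]) (u n)%:E <= C%:E)%E.
Proof.
move=> u0 uC; rewrite -nneseries_esumT; last by move=> n; rewrite lee_fin.
apply: lime_le; first by apply: is_cvg_nneseries => n _ _; rewrite lee_fin.
by apply: nearW => N; rewrite sumEFin lee_fin big_mkord.
Qed.

Lemma geometric_sum_le (q : R) N : 0 <= q < 1 -> \sum_(n < N) q ^+ n <= (1 - q)^-1.
Proof.
move=> /andP[q0 q1]; rewrite -[leRHS]mulr1 ler_pdivlMl ?subr_gt0//.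
have -> : (1 - q) * \sum_(n < N) q ^+ n = 1 - q ^+ N.
  by rewrite -[RHS]opprB subrX1 -mulNr opprB.
by rewrite gerBl exprn_ge0.
Qed.

(* Cauchy condensation, at indices [2^j - 1] since [u] is indexed from 0. *)
Lemma condensation_le (u : nat -> R) (k : nat) : (forall m n, (m <= n)%N -> u n <= u m) ->
  \sum_(0 <= n < (2 ^ k).-1) u n <= \sum_(j < k) 2 ^+ j * u (2 ^ j).-1.
Proof.
move=> ud; elim: k => [|k IH]; first by rewrite big_geq// big_ord0.
have k0 : (0 < 2 ^ k)%N by rewrite expn_gt0.
rewrite big_ord_recr /= (@big_cat_nat _ _ _ (2 ^ k).-1)//=; last first.
  by rewrite expnS; lia.
apply: lerD => //; apply: (@le_trans _ _ (\sum_((2 ^ k).-1 <= n < (2 ^ k.+1).-1) u (2 ^ k).-1)).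
  by rewrite big_nat [leRHS]big_nat; apply: ler_sum => n /andP[h _]; exact: ud.
have -> : 2 ^+ k = (2 ^ k)%:R :> R by rewrite natrX.
rewrite sumr_const_nat (_ : (_ - _)%N = (2 ^ k)%N) ?mulr_natl//.
by rewrite expnS; lia.
Qed.

(** After extension to 2^N - 1 terms, condensation leaves a geometric series of ratio 2^(1-p), which
    is below 1 as p > 1. *)
Lemma sum_powR_le (p : R) N : 1 < p ->
  \sum_(n < N) n.+1%:R `^ (- p) <= (1 - 2 `^ (1 - p))^-1.
Proof.
move=> p1; set q := 2 `^ (1 - p).
have q0 : 0 < q by exact: powR_gt0.
have q1 : q < 1.
  rewrite /q /powR gt_eqF// -[ltRHS](@expR0 R) ltr_expR.
  by rewrite nmulr_rlt0 ?subr_lt0// ln_gt0// ltr1n.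
have u0 n : 0 <= n.+1%:R `^ (- p) :> R by exact: powR_ge0.
apply: (@le_trans _ _ (\sum_(0 <= n < (2 ^ N).-1) n.+1%:R `^ (- p))).
  rewrite -(big_mkord xpredT (fun n => n.+1%:R `^ (- p))).
  rewrite [leRHS](@big_cat_nat _ _ _ N)//=; last by have := ltn_expl N (isT : (1 < 2)%N); lia.
  by rewrite lerDl sumr_ge0.
apply: le_trans (@condensation_le (fun n => n.+1%:R `^ (- p)) N _) _.
  move=> m n mn; rewrite !powRN lef_pV2 ?posrE ?powR_gt0//.
  by apply: ge0_ler_powR; rewrite ?nnegrE// ?ler_nat ?ltnS//; lra.
apply: le_trans (geometric_sum_le N _); last by rewrite ltW.
apply: ler_sum => j _; rewrite prednK ?expn_gt0// natrX.
rewrite -powR_mulrn// -powRrM -powRD; last by rewrite pnatr_eq0 implybT.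
have -> : q ^+ j = 2 `^ ((1 - p) * j%:R) by rewrite powRrM powR_mulrn ?ltW.
by rewrite (_ : _ + _ * _ = (1 - p) * j%:R)//; ring.
Qed.

(* A bound for the sum over [l] of [|2 l + 1|^(-p)]: [|2 l + 1| >= int_index l + 1]. *)
Definition half_int_zeta (p : R) : \bar R :=
  (\esum_(l in [set: int]) ((int_index l).+1%:R `^ (- p))%:E)%E.

Lemma half_int_zeta_fin (p : R) : 1 < p -> (half_int_zeta p < +oo)%E.
Proof.
move=> p1; rewrite /half_int_zeta (esumID (range Posz)); last first.
  by move=> l _; rewrite lee_fin powR_ge0.
have S : (\esum_(n in [set: nat]) (n.+1%:R `^ (- p))%:E < +oo :> \bar R)%E.
  apply: le_lt_trans (esum_nat_le _ _) (ltry _) => [n|N]; first exact: powR_ge0.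
  exact: sum_powR_le.
rewrite (@reindex_esum _ _ _ [set: nat] _ Posz); last first.
  by split=> [n _|m n _ _ []//|l [_ [n _ <-]]]; [split => //; exists n|exists n].
rewrite (@reindex_esum _ _ _ [set: nat] _ Negz); last first.
  split=> [n _|m n _ _ []//|[n|n] [_ h]]; [by split => // -[]|by case: h; exists n|by exists n].
by rewrite lte_add_pinfty.
Qed.

End EsumBounds.

(** * Summability of the gasket modules *)

Section Gasket.
Variables (R : realType) (p : R).
Hypothesis p_gt : ln 3 / ln 2 < p.

Lemma ln2_gt0 : 0 < ln 2 :> R.
Proof. by rewrite ln_gt0// ltr1n. Qed.

Lemma p_gt1 : 1 < p.
Proof.
apply: le_lt_trans p_gt; rewrite ler_pdivlMr ?ln2_gt0// mul1r.
by rewrite ler_ln ?posrE// ler_nat.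
Qed.

Lemma spectral_weight01 t : 0 <= spectral_weight p t <= 1.
Proof.
rewrite powR_ge0 /= /spectral_weight mulNr powRN invf_le1 ?powR_gt0//; last first.
  by rewrite ltr_pwDl// sqr_ge0.
have t1 : 1 <= 1 + t ^+ 2 by rewrite lerDl sqr_ge0.
have p0 : 0 <= p / 2 by have := p_gt1; lra.
by have := ler_powR t1 p0; rewrite powRr0.
Qed.

Lemma spectral_weight_half_int (r : {posnum R}) (l : int) :
  spectral_weight p ((l%:~R + 2^-1) / r%:num) <= (2 * r%:num) `^ p * (int_index l).+1%:R `^ (- p).
Proof.
(* For k = [int_index l], |l + 1/2| = k + 1/2 >= (k + 1) / 2. *)
have nl : (int_index l).+1%:R / 2 <= `|l%:~R + 2^-1 : R|.
  case: l => k /=; have k0 : 0 <= k%:R :> R by [].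
    by rewrite -natr1 ger0_norm -?pmulrn; lra.
  by rewrite NegzE mulrNz -pmulrn -natr1 ler0_norm; lra.
set n : R := (int_index l).+1%:R; set b := 2 * r%:num.
have p1 := p_gt1; have n0 : 0 < n by rewrite ltr0n.
have b0 : 0 < b by rewrite mulr_gt0.
have le1 : (n / b) ^+ 2 <= 1 + ((l%:~R + 2^-1) / r%:num) ^+ 2.
  rewrite -[((_ + _) / _) ^+ 2]real_normK ?num_real// normrM normfV (gtr0_norm (x := r%:num))//.
  apply: (@le_trans _ _ ((`|l%:~R + 2^-1| / r%:num) ^+ 2)); last by rewrite lerDr.
  rewrite lerXn2r ?nnegrE ?divr_ge0 ?(ltW n0) ?(ltW b0)//.
  rewrite /b invfM mulrA; apply: ler_wpM2r => //.
rewrite /spectral_weight mulNr [leLHS]powRN.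
have -> : b `^ p * n `^ (- p) = (((n / b) ^+ 2) `^ (p / 2))^-1.
  rewrite -powR_mulrn ?divr_ge0 ?(ltW n0) ?(ltW b0)// -powRrM.
  rewrite (_ : 2%:R * (p / 2) = p); last by field.
  rewrite powRM ?invr_ge0 ?(ltW n0) ?(ltW b0)//.
  have -> : b^-1 `^ p = (b `^ p)^-1.
    by rewrite -(powR_inv1 (ltW b0)) -powRrM mulN1r powRN.
  by rewrite powRN invfM invrK mulrC.
rewrite lef_pV2 ?posrE ?powR_gt0 ?exprn_gt0 ?divr_gt0//; last first.
  by rewrite ltr_pwDl// sqr_ge0.
apply: ge0_ler_powR => //; rewrite ?nnegrE ?sqr_ge0 ?addr_ge0 ?sqr_ge0//.
by lra.
Qed.

Let zeta := fine (half_int_zeta p).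

Lemma zetaE : half_int_zeta p = zeta%:E.
Proof.
rewrite fineK// ge0_fin_numE ?half_int_zeta_fin ?p_gt1//.
by apply: esum_ge0 => l _; rewrite lee_fin powR_ge0.
Qed.

Lemma zeta_ge0 : 0 <= zeta.
Proof. by rewrite -lee_fin -zetaE; apply: esum_ge0 => l _; rewrite lee_fin powR_ge0. Qed.

Definition fm_diag (M : fredholm_module R) (c : \bar R) :=
  diagonalization (spectral_weight p) (@fm_dirac R M) c.

Lemma fm_diag_le (M : fredholm_module R) (c c' : \bar R) : (c <= c')%E ->
  fm_diag M c -> fm_diag M c'.
Proof.
move=> cc' [I e lam eo ep De mul cost].
by apply: (@Diagonalization _ _ _ _ _ I e lam) => //; exact: le_trans cc'.
Qed.

Lemma fm_diag_dsum (I : choiceType) (M : I -> fredholm_module R) (c : I -> \bar R) :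
  (forall i, fm_diag (M i) (c i)) -> fm_diag (fm_dsum M) (\esum_(i in [set: I]) c i)%E.
Proof. by move=> h; apply: diagonal_dsum => //; exact: spectral_weight01. Qed.

Lemma fm_diag_add (M N : fredholm_module R) (c d : R) : 0 <= c -> 0 <= d ->
  fm_diag M c%:E -> fm_diag N d%:E -> fm_diag (fm_add M N) (c + d)%:E.
Proof.
move=> c0 d0 hM hN.
apply: (@fm_diag_le _ (\esum_(b in [set: bool]) (if b then c else d)%:E)%E); last first.
  by apply: fm_diag_dsum => -[].
apply: le_trans (esum_le_seq (s := [:: true; false]) _ _ _) _ => //.
- by case.
- by case; rewrite lee_fin.
by rewrite !big_cons big_nil adde0 EFinD.
Qed.

(** The Dirac operator depends on [r] only, so one bound serves both orientations of a triangle. *)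
Lemma fm_diag_curve (r : {posnum R}) (rho : R -> R * R) :
  fm_diag (fm_curve r rho) ((2 * r%:num) `^ p * zeta)%:E.
Proof.
apply: arc_diagonal => //; last exact: ltry.
  by move=> t; have /andP[] := spectral_weight01 t.
rewrite EFinM -zetaE.
apply: le_trans (esumZ_le (c := (2 * r%:num) `^ p) (powR_ge0 _ _) _); last first.
  by move=> l; exact: powR_ge0.
by apply: le_esum => l _; rewrite lee_fin spectral_weight_half_int.
Qed.

Lemma size_cells n : size (cells R n) = (3 ^ n)%N.
Proof.
elim: n => //= n IH; rewrite size_flatten /shape -map_comp.
rewrite (_ : [seq _ | _ <- _] = nseq (size (cells R n)) 3).
  by rewrite sumn_nseq IH expnS.
by elim: (cells R n) => //= T s ->.
Qed.

Lemma all_cells n : all (fun T => rad T == 2^-1 ^+ n) (cells R n).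
Proof.
elim: n => [|n IH] /=; first by rewrite expr0 eqxx.
elim: (cells R n) IH => //= T s IHs /andP[/eqP rT rs].
by rewrite rT -exprSr eqxx /=; exact: IHs.
Qed.

Lemma radius_nabla (x : HSG) : rad (nabla R x) = 2^-1 ^+ (val x).1.
Proof.
case: x => [[m k] mk]; rewrite /nabla /=; have /and3P[/= m1 k1 km] := mk.
(* A triangle of level m is the middle of a cell of depth m - 1, and [middle] halves the radius. *)
have /(all_nthP (Delta01 R))/(_ (k - 1)%N) := all_cells (m - 1).
rewrite size_cells => /(_ _)/eqP -> //; last by lia.
by rewrite -exprSr; congr (_ ^+ _); lia.
Qed.

Let level_weight : R := 2^-1 `^ p.
Let cell_weight (x : HSG) : R := level_weight ^+ (val x).1.

Lemma level_weight_ge0 : 0 <= level_weight. Proof. exact: powR_ge0. Qed.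

(** The critical exponent enters here: 3 * 2^(-p) < 1 amounts to p ln 2 > ln 3. *)
Lemma level_weight3_lt1 : 3 * level_weight < 1.
Proof.
have l2 := ln2_gt0.
rewrite /level_weight /powR gt_eqF ?invr_gt0// lnV ?posrE// mulrN expRN ltr_pdivrMr ?expR_gt0// mul1r.
rewrite -[ltLHS](@lnK R 3) ?posrE// ltr_expR.
by move: p_gt; rewrite ltr_pdivrMr.
Qed.

Lemma nabla_cost (x : HSG) :
  (2 * rad (nabla R x)) `^ p * zeta = 2 `^ p * zeta * cell_weight x.
Proof.
rewrite radius_nabla powRM ?exprn_ge0// -powR_mulrn// powRAC powR_mulrn ?powR_ge0//.
by rewrite mulrAC.
Qed.

(* There are 3^(m-1) triangles at level m, each of weight (2^-p)^m. *)
Lemma esum_HSG_le : (\esum_(x in [set: HSG]) (cell_weight x)%:E <= ((1 - 3 * level_weight)^-1)%:E)%E.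
Proof.
pose J (m : nat) := [set k | [&& 1 <= m, 1 <= k & k <= 3 ^ (m - 1)]%N].
have <- : (\esum_(k in [set: nat] `*`` J) (level_weight ^+ k.1)%:E =
           \esum_(x in [set: HSG]) (cell_weight x)%:E)%E.
  apply: (@reindex_esum _ _ _ _ _ (val : HSG -> nat * nat) (fun k => (level_weight ^+ k.1)%:E)).
  split=> [[mk h] _ //|x y _ _ /val_inj//|mk [_ h]].
  by exists (exist _ mk h).
rewrite -(@esum_esum _ _ _ setT J (fun m _ => (level_weight ^+ m)%:E)); last first.
  by move=> m k _ _; rewrite lee_fin exprn_ge0 ?level_weight_ge0.
apply: (@le_trans _ _ (\esum_(m in [set: nat]) ((3 * level_weight) ^+ m)%:E)%E).
  (* The index set at level m lies in [iota 1 (3 ^ m)]. Counting 3^m instead of 3^(m-1) gives a pure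
     power of the ratio, also at m = 0, where the set is empty. *)
  apply: le_esum => m _; rewrite exprMn -natrX -[X in X%:R * _](size_iota 1).
  apply: esum_cst_le; rewrite ?iota_uniq ?exprn_ge0 ?level_weight_ge0// => k /and3P[m1 k1 km].
  rewrite mem_iota k1 add1n ltnS (leq_trans km)// leq_exp2l//; lia.
apply: esum_nat_le => [n|N].
  by rewrite exprn_ge0// mulr_ge0// level_weight_ge0.
by apply: geometric_sum_le; rewrite mulr_ge0 ?level_weight_ge0//= level_weight3_lt1.
Qed.

Let nabla_total := 2 `^ p * zeta * (1 - 3 * level_weight)^-1.

Lemma nabla_total_ge0 : 0 <= nabla_total.
Proof.
by rewrite !mulr_ge0 ?powR_ge0 ?zeta_ge0// invr_ge0 subr_ge0 ltW// level_weight3_lt1.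
Qed.

Lemma esum_nabla_le :
  (\esum_(x in [set: HSG]) ((2 * rad (nabla R x)) `^ p * zeta)%:E <= nabla_total%:E)%E.
Proof.
under eq_esum do rewrite nabla_cost.
apply: le_trans (esumZ_le _ _) _.
- by rewrite mulr_ge0 ?powR_ge0 ?zeta_ge0.
- by move=> x; rewrite exprn_ge0// level_weight_ge0.
rewrite [nabla_total%:E]EFinM; apply: lee_wpmul2l; last exact: esum_HSG_le.
by rewrite lee_fin mulr_ge0 ?powR_ge0 ?zeta_ge0.
Qed.

Lemma fm_diag_ZGT : fm_diag (ZGT R) ((2 * 1) `^ p * zeta + nabla_total)%:E.
Proof.
apply: fm_diag_add.
- by rewrite mulr_ge0 ?powR_ge0 ?zeta_ge0.
- exact: nabla_total_ge0.
- exact: fm_diag_curve.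
apply: fm_diag_le esum_nabla_le _; apply: fm_diag_dsum => x.
exact: fm_diag_curve.
Qed.

(** Both signs of [f x] give the same cost, so only the multiplicity |f x| <= B enters, as a factor
    in front of the sum over all triangles. *)
Lemma fm_diag_UFMf (f : HSG -> int) (B : R) : 0 <= B ->
  (forall x, (`|f x|%N)%:R <= B) -> fm_diag (UFMf R f) (B * nabla_total)%:E.
Proof.
move=> B0 fB.
pose c x := (2 * rad (nabla R x)) `^ p * zeta.
have c0 x : 0 <= c x by rewrite mulr_ge0 ?powR_ge0 ?zeta_ge0.
apply: (@fm_diag_le _ (\esum_(i in [set: {x : HSG & 'I_(`|f x|%N)}]) (c (tag i))%:E)%E); last first.
  by apply: fm_diag_dsum => i; case: ifP => _; exact: fm_diag_curve.
rewrite esum_sigma; last by move=> k; rewrite lee_fin.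
apply: (@le_trans _ _ (\esum_(x in [set: HSG]) (B * c x)%:E)%E).
  apply: le_esum => x _ /=.
  apply: le_trans (esum_cst_le (enum_uniq 'I_(`|f x|%N)) _ (c0 x)) _.
    by move=> i _; rewrite mem_enum.
  by rewrite size_enum_ord lee_fin; apply: ler_wpM2r.
apply: le_trans (esumZ_le B0 c0) _; rewrite EFinM.
by apply: lee_wpmul2l; [rewrite lee_fin|exact: esum_nabla_le].
Qed.

End Gasket.

Theorem corollary3p8 (R : realType) (f : HSG -> int)
    (f_bounded : (ereal_sup (range (fun x : HSG => (`|f x|%:~R : R)%:E)) < +oo)%E)
    (p : R) (p_gt : (ln 3 / ln 2 : R) < p) :
  fm_summable (ST R f) p.
Proof.
have [B B0 fB] : exists2 B : R, 0 <= B & forall x, (`|f x|%N)%:R <= B.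
  have h x : ((`|f x|%N%:R : R)%:E <= ereal_sup (range (fun x : HSG => (`|f x|%:~R : R)%:E)))%E.
    by apply: ereal_sup_ubound; exists x => //; rewrite -abszE -pmulrn.
  move: f_bounded h; case: ereal_sup => [b _ h|//|_ h].
    exists (Num.max b 0); first by rewrite le_max lexx orbT.
    by move=> x; rewrite le_max; have := h x; rewrite lee_fin => ->.
  (* A supremum equal to -oo would put a natural number below -oo, which is absurd. *)
  by exists 0 => // x; have := h x; rewrite leeNy_eq.
apply: (@diagonal_summable _ _ _ _ _ _ (ltry _)).
apply: (fm_diag_add p_gt _ _ (fm_diag_ZGT p_gt) (fm_diag_UFMf p_gt B0 fB)).
- by rewrite addr_ge0 ?nabla_total_ge0// mulr_ge0 ?powR_ge0 ?zeta_ge0.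
- by rewrite mulr_ge0 ?nabla_total_ge0.
Qed.
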